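(* Let $\Gamma=\mathrm{SL}_3(\mathbb{Z})$. For a prime $q$ let $P_q=P^2(\mathbb{F}_q)$ and let $\Phi_q:\mathrm{SL}_3(\mathbb{Z})\to\mathrm{Sym}(P_q)$ be the action obtained by reducing modulo $q$ and acting naturally on $P_q$. Then there exists a constant $C>0$ such that for every $\epsilon>0$ there is a constant $A_\epsilon$ such that for every prime $q$ and every $T\le Cq^2$, \[ \left|\left\{(\gamma,x)\in\mathrm{SL}_3(\mathbb{Z})\times P^2(\mathbb{F}_q):\|\gamma\|_\infty\|\gamma^{-1}\|_\infty\le T,\ \Phi_q(\gamma)(x)=x\right\}\right|\le A_\epsilon\, q^{2+\epsilon}T. \]
   Context: $\|\gamma\|_\infty$ denotes the maximum absolute value of the entries of the matrix $\gamma$. $P^2(\mathbb{F}_q)$ is the set of nonzero vectors of $\mathbb{F}_q^3$ modulo scalars in $\mathbb{F}_q^\times$. *)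

(* Defs.v *)
From HB Require Import structures.
From mathcomp Require Import all_boot all_order all_algebra all_fingroup.
From mathcomp Require Import all_classical all_reals all_analysis.

Set Implicit Arguments.
Unset Strict Implicit.
Unset Printing Implicit Defensive.

Import Order.TTheory GRing.Theory Num.Theory.
Local Open Scope ring_scope.

Record SL3Z := MkSL3Z { SL3Z_mx :> 'M[int]_3; _ : \det SL3Z_mx == 1 }.
HB.instance Definition _ := [isSub for SL3Z_mx].
HB.instance Definition _ := [Choice of SL3Z by <:].

Section ProjectivePlane.
Variable F : finFieldType.

Definition nzvec : {set 'cV[F]_3} := [set v | v != 0].

Definition proportional : rel 'cV[F]_3 :=
  fun u v => [exists a : F, (a != 0) && (v == a *: u)].

Lemma proportionalP (u v : 'cV[F]_3) :
  reflect (exists2 a : F, a != 0 & v = a *: u) (proportional u v).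
Proof.
apply: (iffP existsP) => [[a /andP[a0 /eqP e]]|[a a0 e]]; exists a => //.
by rewrite a0 e eqxx.
Qed.

Lemma proportional_equiv :
  {in nzvec & &, equivalence_rel proportional}.
Proof.
have refl u : proportional u u.
  by apply/proportionalP; exists 1; rewrite ?oner_neq0 ?scale1r.
have sym u v : proportional u v -> proportional v u.
  move=> /proportionalP[a a0 e]; apply/proportionalP; exists a^-1.
    by rewrite invr_eq0.
  by rewrite e scalerA mulVf // scale1r.
have trans u v w : proportional u v -> proportional v w -> proportional u w.
  move=> /proportionalP[a a0 ea] /proportionalP[b b0 eb].
  apply/proportionalP; exists (b * a); first by rewrite mulf_neq0.
  by rewrite eb ea scalerA.
move=> u v w _ _ _; split=> // uv.
by apply/idP/idP; [apply: trans (sym _ _ uv) | apply: trans uv].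
Qed.

(* The points are the proportionality classes of nonzero vectors. *)
Record P2 := MkP2 {
  P2_class : {set 'cV[F]_3};
  _ : P2_class \in equivalence_partition proportional nzvec }.
HB.instance Definition _ := [isSub for P2_class].
HB.instance Definition _ := [Finite of P2 by <:].

End ProjectivePlane.

Section Action.
Variable q : nat.

Definition redmx (g : SL3Z) : 'M['F_q]_3 := map_mx intr g.

Lemma redmx_unit (g : SL3Z) : redmx g \in unitmx.
Proof. by rewrite unitmxE det_map_mx (eqP (valP g)) rmorph1 unitr1. Qed.

Lemma redmx_inj (g : SL3Z) : injective (mulmx (redmx g) : 'cV_3 -> 'cV_3).
Proof. exact: can_inj (mulKmx (redmx_unit g)). Qed.

Lemma redmx_proportional (g : SL3Z) (u v : 'cV['F_q]_3) :
  proportional (redmx g *m u) (redmx g *m v) = proportional u v.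
Proof.
apply/proportionalP/proportionalP => -[a a0 e]; exists a => //.
  by apply: (@redmx_inj g); rewrite -scalemxAr.
by rewrite e scalemxAr.
Qed.

Lemma redmx_nzvec (g : SL3Z) (v : 'cV['F_q]_3) :
  (redmx g *m v \in nzvec 'F_q) = (v \in nzvec 'F_q).
Proof. by rewrite !inE -[in RHS](inj_eq (@redmx_inj g)) mulmx0. Qed.

Lemma P2_act_subproof (g : SL3Z) (x : P2 'F_q) :
  mulmx (redmx g) @: P2_class x
    \in equivalence_partition (@proportional 'F_q) (nzvec 'F_q).
Proof.
have /imsetP[v v0 ->] := valP x.
apply/imsetP; exists (redmx g *m v); first by rewrite redmx_nzvec.
apply/setP => w; rewrite [RHS]inE; apply/imsetP/andP => [[u + ->]|[w0 vw]].
  by rewrite inE redmx_nzvec redmx_proportional => /andP.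
have ew := mulKVmx (redmx_unit g) w.
exists (invmx (redmx g) *m w); last by rewrite ew.
by rewrite inE -(redmx_nzvec g) -(redmx_proportional g) ew w0.
Qed.

Definition P2_act (g : SL3Z) (x : P2 'F_q) : P2 'F_q :=
  MkP2 (P2_act_subproof g x).

Lemma P2_act_inj (g : SL3Z) : injective (P2_act g).
Proof.
move=> x y [] e; apply: val_inj; apply: imset_inj e; exact: redmx_inj.
Qed.

Definition Phi (g : SL3Z) : {perm P2 'F_q} := perm (@P2_act_inj g).

End Action.

(* Over [int], [mx_norm] is the maximum absolute value of the entries. *)
Definition fixed_pairs (R : realType) (q : nat) (T : R) :
    set (SL3Z * P2 'F_q) :=
  [set gx | (mx_norm (SL3Z_mx gx.1) * mx_norm (invmx (SL3Z_mx gx.1)))%:~R <= T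
            /\ Phi q gx.1 gx.2 = gx.2]%classic.

Arguments fixed_pairs {R} q T.

(* Main.v *)
(* Fixed points of gamma on P^2(F_q) are its eigenlines mod q, so there are at
   most three of them unless gamma = lambda + x y^T mod q for a column x and a
   row y, when there are O(q), or gamma is scalar mod q, when there are O(q^2).
   It is enough to bound the number of gamma of each kind with
   |gamma| |gamma^-1| <= T <= q^2/256, up to factors q^eps from divisor bounds.

   All gamma: T^2 <= q^2 T. Up to an elementary transformation, the largest row u
   of gamma and the largest column v of gamma^-1 have different indices; then
   u.v = 0, |u| |v| <= 9 T, and (u, v) determines gamma up to O(1) choices.

   gamma = lambda + x y^T mod q: q T. Put a = |gamma| and b = |gamma^-1|, and assume
   a <= b by passing to the inverse. The a^3 choices of the diagonal leave three
   choices for lambda, which fixes the diagonal of gamma^-1 modulo q, hence up to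
   (1 + 2 b / q)^3 choices; its entries are the minors
   gamma_ii gamma_jj - gamma_ij gamma_ji, so the products gamma_ij gamma_ji are
   known, and the divisor bound finishes the count when they are nonzero.

   gamma scalar mod q: O(1), since the smaller of gamma and gamma^-1 has entries
   less than q, so it is diagonal. *)

From HB Require Import structures.
Require Import Defs.
From mathcomp Require Import all_boot all_order all_algebra all_fingroup.
From mathcomp Require Import finmap.
From mathcomp Require Import zify ring.
From mathcomp Require Import all_classical all_reals all_analysis.

Set Implicit Arguments.
Unset Strict Implicit.
Unset Printing Implicit Defensive.

Import Order.TTheory GRing.Theory Num.Theory.
Local Open Scope ring_scope.

(** * Counting by covering lists *)

(** An upper bound for a count that presupposes neither decidability nor finiteness of [P];
    [covered_set] turns it into a cardinality at the end. *)
Definition covered (T : eqType) (P : T -> Prop) (n : nat) :=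
  exists2 s : seq T, (size s <= n)%N & forall x, P x -> x \in s.

Lemma covered_sub (T : eqType) (P Q : T -> Prop) (m n : nat) :
  covered Q m -> (forall x, P x -> Q x) -> (m <= n)%N -> covered P n.
Proof.
move=> [s sm sQ] PQ mn; exists s; first exact: leq_trans mn.
by move=> x /PQ /sQ.
Qed.

Lemma covered_seq (T : eqType) (P : T -> Prop) (s : seq T) :
  (forall x, P x -> x \in s) -> covered P (size s).
Proof. by move=> Ps; exists s. Qed.

Lemma covered0 (T : eqType) (P : T -> Prop) (n : nat) :
  (forall x, ~ P x) -> covered P n.
Proof. by move=> P0; exists [::] => // x /P0. Qed.

Lemma covered1 (T : eqType) (P : T -> Prop) :
  (forall x y, P x -> P y -> x = y) -> covered P 1.
Proof.
move=> P1; have [[x Px]|nP] := pselect (exists x, P x).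
  by exists [:: x] => // y Py; rewrite inE (P1 _ _ Py Px).
by apply: covered0 => x Px; apply: nP; exists x.
Qed.

Lemma coveredU (T : eqType) (P Q : T -> Prop) (m n : nat) :
  covered P m -> covered Q n -> covered (fun x => P x \/ Q x) (m + n).
Proof.
move=> [s sm sP] [r rn rQ]; exists (s ++ r).
  by rewrite size_cat leq_add.
by move=> x; rewrite mem_cat => -[/sP ->|/rQ ->] //; rewrite orbT.
Qed.

Lemma covered_bigU (T U : eqType) (s : seq U) (P : U -> T -> Prop) (n m : nat) :
  (size s <= n)%N -> (forall u, u \in s -> covered (P u) m) ->
  covered (fun x => exists2 u, u \in s & P u x) (n * m).
Proof.
move=> sn Pm; pose Q x := exists2 u, u \in s & P u x.
suff Qm : covered Q (size s * m).
  by apply: (covered_sub Qm) => //; rewrite leq_mul2r sn orbT.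
rewrite {}/Q; elim: s {sn} Pm => [|u s IH] Pm; first by apply: covered0 => x [].
rewrite /= mulSn; apply: (covered_sub (coveredU (Pm u _) (IH _))) => //.
- by rewrite mem_head.
- by move=> v vs; apply: Pm; rewrite inE vs orbT.
move=> x [v]; rewrite inE => /predU1P[->|vs] Px; first by left.
by right; exists v.
Qed.

(** The list covering [Q] may contain points outside [Q]; their fibres are empty because [f] maps
    [P] into [Q], so only fibres over [Q] need a bound. *)
Lemma covered_fiber (T U : eqType) (f : T -> U) (P : T -> Prop)
    (Q : U -> Prop) (n m : nat) :
  covered Q n -> (forall x, P x -> Q (f x)) ->
  (forall u, Q u -> covered (fun x => P x /\ f x = u) m) ->
  covered P (n * m).
Proof.
move=> [s sn sQ] PQ Fm.
have Fm' u : u \in s -> covered (fun x => P x /\ f x = u) m.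
  move=> _; have [Qu|nQ] := pselect (Q u); first exact: Fm.
  by apply: covered0 => x [/PQ + fx]; rewrite fx.
apply: (covered_sub (covered_bigU sn Fm')) => // x Px.
by exists (f x) => //; apply/sQ/PQ.
Qed.

Lemma covered_inj (T U : eqType) (f : T -> U) (P : T -> Prop)
    (Q : U -> Prop) (n : nat) :
  covered Q n -> (forall x, P x -> Q (f x)) ->
  (forall x y, P x -> P y -> f x = f y -> x = y) -> covered P n.
Proof.
move=> Qn PQ fI; rewrite -[n]muln1; apply: (covered_fiber Qn PQ) => u _.
by apply: covered1 => x y [Px <-] [Py fy]; apply: fI.
Qed.

Lemma coveredX (T U : eqType) (P : T -> Prop) (Q : U -> Prop) (m n : nat) :
  covered P m -> covered Q n -> covered (fun z => P z.1 /\ Q z.2) (m * n).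
Proof.
move=> Pm Qn; apply: (covered_fiber (f := fst) Pm) => [z []//|x _].
by apply: (covered_inj (f := snd) Qn) => [z [[]]//|[a b] [c d] /= [_ ->] [_ ->] ->].
Qed.

Lemma covered_uniq (T : eqType) (s : seq T) (P : T -> Prop) (n : nat) :
  uniq s -> (forall x, x \in s -> P x) -> covered P n -> (size s <= n)%N.
Proof.
move=> us sP [r rn rP]; apply: leq_trans rn; apply: uniq_leq_size => // x xs.
exact/rP/sP.
Qed.

(** * The divisor bound *)

(** A divisor is determined by its [p]-adic valuation, at most [e], and its [p]-free part, which
    divides [m]. *)
Lemma size_divisors_coprime (p e m : nat) :
  prime p -> (0 < m)%N -> coprime p m ->
  (size (divisors (p ^ e * m)) <= e.+1 * size (divisors m))%N.
Proof.
move=> pp m0 pm; have p0 := prime_gt0 pp.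
have n0 : (0 < p ^ e * m)%N by rewrite muln_gt0 expn_gt0 p0.
have c1 : covered (fun i : nat => (i < e.+1)%N) e.+1.
  by exists (iota 0 e.+1); rewrite ?size_iota // => x; rewrite mem_iota.
have c2 : covered (fun d => d \in divisors m) (size (divisors m)).
  exact: covered_seq.
apply: (covered_uniq (divisors_uniq _)
  (P := fun d => d \in divisors (p ^ e * m))) => //.
apply: (covered_inj (f := fun d => (logn p d, (d`_p^')%N)) (coveredX c1 c2)) => /=.
  move=> d; rewrite -!dvdn_divisors // => dn.
  have d0 : (0 < d)%N by apply: dvdn_gt0 dn.
  have := dvdn_leq_log p n0 dn.
  rewrite lognM // ?expn_gt0 ?p0 // pfactorK // [logn p m]lognE pp m0 /=.
  have -> : (p %| m)%N = false by apply/negbTE; rewrite -prime_coprime.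
  rewrite addn0 ltnS => -> ; split=> //.
  have cop : coprime (d`_p^')%N (p ^ e)%N.
    rewrite coprimeXr // coprime_sym prime_coprime //.
    apply/negP => pd; have := part_pnat p^' d; rewrite /pnat => /andP[_ /allP /(_ p)].
    by rewrite mem_primes pp part_gt0 pd => /(_ isT); rewrite !inE eqxx.
  by rewrite -(Gauss_dvdr _ cop); apply: dvdn_trans dn; apply: dvdn_part.
move=> d d' dn dn' [l1 l2].
have d0 : (0 < d)%N by move: dn; rewrite -dvdn_divisors // => /(dvdn_gt0 n0).
have d0' : (0 < d')%N by move: dn'; rewrite -dvdn_divisors // => /(dvdn_gt0 n0).
by rewrite -(partnC p d0) -(partnC p d0') !p_part l1 l2.
Qed.

Lemma leq_exp2rW (m n e : nat) : (m <= n)%N -> (m ^ e <= n ^ e)%N.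
Proof. by case: e => [|e] mn //; rewrite leq_exp2r. Qed.

(** With [f = e %/ k] one has [e + 1 <= k * (f + 1) <= k * 2 ^ f], and [f * k <= e]. *)
Lemma expn_succ_le (k e : nat) : (0 < k)%N -> (e.+1 ^ k <= k ^ k * 2 ^ e)%N.
Proof.
move=> k0; apply: (@leq_trans ((k * 2 ^ (e %/ k)) ^ k)).
  rewrite leq_exp2r //; apply: leq_trans (_ : k * (e %/ k).+1 <= _)%N.
    by rewrite mulnC ltn_ceil.
  by rewrite leq_mul2l ltn_expl // orbT.
rewrite expnMn leq_mul2l -expnM leq_exp2l //.
by rewrite leq_divM orbT.
Qed.

(** The divisor bound [d(n) = O(n ^ (1 / k))] with the root cleared. The induction runs along a list
    containing the primes of [n] and removes one full prime power at a time. *)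
Lemma size_divisors_bound (k : nat) : (0 < k)%N ->
  exists2 C, (0 < C)%N & forall n, (0 < n)%N -> (size (divisors n) ^ k <= C * n)%N.
Proof.
move=> k0; pose c := (k ^ k)%N.
have c0 : (0 < c)%N by rewrite expn_gt0 k0.
(* Only the primes below [2 ^ k] cost a factor [c], since [e.+1 ^ k <= (2 ^ k) ^ e]. *)
have H : forall s n, (0 < n)%N -> {subset primes n <= s} ->
    (size (divisors n) ^ k <= c ^ count (fun p => p < 2 ^ k)%N s * n)%N.
  elim=> [|p s IH] n n0 sub.
    have -> : n = 1%N.
      apply/eqP; rewrite eqn_leq n0 andbT leqNgt; apply/negP => n1.
      by have := sub (pdiv n); rewrite mem_primes pdiv_prime // n0 pdiv_dvd => /(_ isT).
    by rewrite exp1n.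
  have [pp|np] := boolP (prime p); last first.
    apply: leq_trans (IH n n0 _) _.
      move=> r rn; have := sub r rn; rewrite inE => /predU1P[rp|//].
      by move: rn; rewrite rp mem_primes (negbTE np).
    by rewrite leq_mul2r leq_pexp2l ?orbT //= leq_addl.
  pose m := (n`_p^')%N; have m0 : (0 < m)%N by rewrite part_gt0.
  have nE : n = (p ^ logn p n * m)%N by rewrite -p_part partnC.
  have pm : coprime p m.
    rewrite prime_coprime //; apply/negP => pd.
    have := part_pnat p^' n; rewrite /pnat => /andP[_ /allP /(_ p)].
    by rewrite mem_primes pp part_gt0 pd => /(_ isT); rewrite !inE eqxx.
  have /IH : {subset primes m <= s}.
    move=> r; rewrite mem_primes => /and3P[pr _ rm].
    have := sub r; rewrite mem_primes pr n0 (dvdn_trans rm (dvdn_part _ _)) => /(_ isT).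
    rewrite inE => /predU1P[rp|//].
    by move: pm; rewrite -rp prime_coprime // rm.
  move=> /(_ m0) IHm; rewrite {1}nE.
  have := size_divisors_coprime (logn p n) pp m0 pm.
  rewrite -(leq_exp2r _ _ k0) expnMn => /leq_trans; apply.
  rewrite {2}nE /=; set e := logn p n.
  have He : (e.+1 ^ k <= c ^ (p < 2 ^ k)%N * p ^ e)%N.
    case: ltnP => pk.
      apply: leq_trans (expn_succ_le e k0) _; rewrite expn1 leq_mul2l.
      by rewrite leq_exp2rW ?orbT //  prime_gt1.
    rewrite expn0 mul1n; apply: leq_trans (_ : (2 ^ k) ^ e <= _)%N.
      by rewrite -expnM mulnC expnM leq_exp2r // ltn_expl.
    exact: leq_exp2rW.
  apply: leq_trans (leq_mul He IHm) _; rewrite expnD.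
  by apply/eq_leq; ring.
exists (c ^ (2 ^ k))%N; first by rewrite expn_gt0 c0.
move=> n n0; apply: leq_trans (H (primes n) n n0 _) _ => //.
(* The primes of [n] below [2 ^ k] are distinct members of [iota 0 (2 ^ k)], so the exponent of [c]
   is at most [2 ^ k]. *)
rewrite leq_mul2r leq_pexp2l ?orbT // -size_filter.
rewrite -[X in (_ <= X)%N](size_iota 0); apply: uniq_leq_size.
  exact/filter_uniq/primes_uniq.
by move=> r; rewrite mem_filter mem_iota => /andP[].
Qed.


(** * Orthogonal pairs of integer vectors *)

Lemma ord3_third (i j : 'I_3) : i != j -> exists k, uniq [:: i; j; k].
Proof.
(* The three indices sum to 0 modulo 3. *)
move=> ij; exists (- (i + j)); move: ij.
by case: i => [[|[|[|//]]] ?]; case: j => [[|[|[|//]]] ?].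
Qed.

Lemma ord3_all (i j k x : 'I_3) : uniq [:: i; j; k] -> x \in [:: i; j; k].
Proof.
by case: i => [[|[|[|//]]] ?]; case: j => [[|[|[|//]]] ?];
   case: k => [[|[|[|//]]] ?] // _; case: x => [[|[|[|//]]] ?].
Qed.

Lemma ord3_ind (i j k : 'I_3) (P : 'I_3 -> Prop) : uniq [:: i; j; k] ->
  P i -> P j -> P k -> forall x, P x.
Proof.
by move=> u Pi Pj Pk x; move: (ord3_all x u); rewrite !inE => /or3P[]/eqP->.
Qed.

Lemma ord3_sum (V : zmodType) (F : 'I_3 -> V) (i j k : 'I_3) :
  uniq [:: i; j; k] -> \sum_x F x = F i + F j + F k.
Proof.
move=> u; rewrite (perm_big [:: i; j; k]) /=.
  by rewrite !big_cons big_nil addr0 addrA.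
apply: uniq_perm => // [|x]; first exact: index_enum_uniq.
by rewrite mem_index_enum ord3_all.
Qed.

Lemma covered_box (a : nat) : covered (fun z : int => (absz z <= a)%N) a.*2.+1.
Proof.
exists [seq i%:Z - a%:Z | i <- iota 0 a.*2.+1]; first by rewrite size_map size_iota.
move=> z za; apply/mapP; exists (absz (z + a%:Z)); last lia.
by rewrite mem_iota; lia.
Qed.

Lemma covered_box3 (a : nat) : (0 < a)%N ->
  covered (fun z : int => (absz z <= a)%N) (3 * a).
Proof. by move=> a0; apply: (covered_sub (covered_box a)) => //; lia. Qed.

Definition maxdiv (N : nat) : nat := \max_(n < N.+1) size (divisors n).

Lemma leq_maxdiv (n N : nat) : (n <= N)%N -> (size (divisors n) <= maxdiv N)%N.
Proof. by move=> nN; apply: (leq_bigmax (Ordinal (nN : (n < N.+1)%N))). Qed.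

Lemma maxdiv_gt0 (N : nat) : (0 < N)%N -> (0 < maxdiv N)%N.
Proof. by move/leq_maxdiv; apply: leq_trans. Qed.

Lemma covered_factor (p : int) (N : nat) : p != 0 -> (absz p <= N)%N ->
  covered (fun z : int => exists w, z * w = p) (2 * maxdiv N).
Proof.
move=> p0 pN; have ap0 : (0 < absz p)%N by rewrite absz_gt0.
pose s := [seq (d : nat)%:Z | d <- divisors (absz p)] ++ [seq - (d : nat)%:Z | d <- divisors (absz p)].
exists s.
  by rewrite size_cat !size_map addnn -mul2n leq_mul2l leq_maxdiv.
move=> z [w zw]; have zd : absz z \in divisors (absz p).
  by rewrite -dvdn_divisors // -zw abszM dvdn_mulr.
rewrite mem_cat; case: (lerP 0 z) => z0.
  by apply/orP; left; apply/mapP; exists (absz z) => //; lia.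
by apply/orP; right; apply/mapP; exists (absz z) => //; lia.
Qed.

Definition orth_pair (a b : nat) (w : 'rV[int]_3 * 'rV[int]_3) : Prop :=
  [/\ w.1 != 0, w.2 != 0, \sum_k w.1 0 k * w.2 0 k = 0,
     forall k, (absz (w.1 0%R k) <= a)%N & forall k, (absz (w.2 0%R k) <= b)%N].

Lemma rV3_inj (u v : 'rV[int]_3) (i j k : 'I_3) : uniq [:: i; j; k] ->
  u 0 i = v 0 i -> u 0 j = v 0 j -> u 0 k = v 0 k -> u = v.
Proof.
move=> ijk ui uj uk; apply/rowP => x; move: x.
exact: (ord3_ind (P := fun x => u 0 x = v 0 x) ijk).
Qed.

Lemma covered_quad (a b : nat) : (0 < a)%N -> (0 < b)%N ->
  covered (fun z : (int * int) * (int * int) =>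
    ((absz z.1.1 <= a)%N /\ (absz z.1.2 <= a)%N) /\
    ((absz z.2.1 <= b)%N /\ (absz z.2.2 <= b)%N)) (81 * (a * b) ^ 2).
Proof.
move=> a0 b0; have Ha := covered_box3 a0; have Hb := covered_box3 b0.
by apply: (covered_sub (coveredX (coveredX Ha Ha) (coveredX Hb Hb))) => //; lia.
Qed.

(** If some product [u_m v_m] is nonzero, the four coordinates away from [m] determine it by
    orthogonality, and [u_m] is one of its divisors. If all products vanish, nonzero entries [u_i]
    and [v_j] force [v_i = u_j = 0] with [i != j], and only four coordinates remain free. The
    constant is [972 = 3 * 81 * 2 + 6 * 81]. *)
Lemma covered_orth_pair (a b N : nat) : (0 < a)%N -> (0 < b)%N ->
  (2 * (a * b) <= N)%N ->
  covered (orth_pair a b) (972 * (a * b) ^ 2 * maxdiv N).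
Proof.
move=> a0 b0 abN.
have N0 : (0 < N)%N by nia.
have D0 := maxdiv_gt0 N0.
pose P1 (m : 'I_3) w := orth_pair a b w /\ w.1 0 m * w.2 0 m != 0.
pose P2 (ij : 'I_3 * 'I_3) (w : 'rV[int]_3 * 'rV[int]_3) :=
  [/\ orth_pair a b w, ij.1 != ij.2, w.1 0 ij.2 = 0 & w.2 0 ij.1 = 0].
have H1 m : covered (P1 m) (81 * (a * b) ^ 2 * (2 * maxdiv N)).
  have [j mj] : exists j, m != j.
    by exists (m + 1); move: m => [[|[|[|//]]] ?].
  have [k mjk] := ord3_third mj.
  apply: (covered_fiber (f := fun w : 'rV[int]_3 * 'rV[int]_3 => ((w.1 0 j, w.1 0 k), (w.2 0 j, w.2 0 k)))
    (covered_quad a0 b0)) => [w [[_ _ _ wa wb] _]|] //=.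
  move=> [[uj uk] [vj vk]] /= [[uja uka] [vjb vkb]].
  have [p0|p0] := eqVneq (uj * vj + uk * vk) 0.
    apply: covered0 => w [[[_ _ s0 _ _] /eqP n0] [e1 e2 e3 e4]]; apply: n0.
    by move: s0; rewrite (ord3_sum _ mjk) -addrA e1 e2 e3 e4 p0 addr0.
  have q0 : - (uj * vj + uk * vk) != 0 by rewrite oppr_eq0.
  have qN : (absz (- (uj * vj + uk * vk)) <= N)%N.
    have : (absz uj * absz vj <= a * b)%N by rewrite leq_mul.
    have : (absz uk * absz vk <= a * b)%N by rewrite leq_mul.
    rewrite -!abszM; lia.
  apply: (covered_inj (f := fun w : 'rV[int]_3 * 'rV[int]_3 => w.1 0 m) (covered_factor q0 qN)).
    move=> w [[[_ _ s0 _ _] _] [e1 e2 e3 e4]]; exists (w.2 0 m).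
    by move: s0; rewrite (ord3_sum _ mjk) -addrA e1 e2 e3 e4 => /eqP; rewrite addr_eq0 => /eqP.
  move=> [u v] [u' v'] /= [[[_ _ /= s0 _ _] /= n0] [e1 e2 e3 e4]].
  move=> [[[_ _ /= s0' _ _] n0'] [e1' e2' e3' e4']] eu.
  have ev : v 0 m = v' 0 m.
    move: s0 s0'; rewrite !(ord3_sum _ mjk) -!addrA e1 e2 e3 e4 e1' e2' e3' e4' -eu.
    move=> <- /addIr /mulfI -> //.
    by apply: contraNneq n0 => ->; rewrite mul0r.
  congr pair; first by apply: (rV3_inj mjk); rewrite ?eu ?e1 ?e2.
  by apply: (rV3_inj mjk); rewrite ?ev ?e3 ?e4.
have H2 ij : covered (P2 ij) (81 * (a * b) ^ 2).
  have [ij0|ij0] := eqVneq ij.1 ij.2.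
    by apply: covered0 => w [_ + _ _]; rewrite ij0 eqxx.
  have [k ijk] := ord3_third ij0.
  apply: (covered_inj (f := fun w : 'rV[int]_3 * 'rV[int]_3 => ((w.1 0 ij.1, w.1 0 k), (w.2 0 ij.2, w.2 0 k)))
    (covered_quad a0 b0)) => [w [[_ _ _ wa wb] _ _ _]|] //=.
  move=> [u v] [u' v'] [/= _ _ e1 e2] [/= _ _ e1' e2'] [e3 e4 e5 e6].
  by congr pair; apply: (rV3_inj ijk); rewrite ?e1 ?e2 ?e1' ?e2'.
have C1 := covered_bigU (s := enum 'I_3) (n := 3) _ (fun m _ => H1 m).
have C2 := covered_bigU
  (s := [:: (0, 1); (0, 2); (1, 0); (1, 2); (2, 0); (2, 1)] : seq ('I_3 * 'I_3))
  (n := 6) _ (fun m _ => H2 m).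
apply: (covered_sub (coveredU (C1 _) (C2 _))) => //.
- by rewrite size_enum_ord.
- move=> w Pw; have [/existsP[m wm]|nm] := boolP [exists m, w.1 0 m * w.2 0 m != 0].
    by left; exists m; rewrite ?mem_enum.
  right; have z m : w.1 0 m * w.2 0 m = 0.
    by apply: contraNeq nm => wm; apply/existsP; exists m.
  have [u0 v0 _ _ _] := Pw.
  have /rV0Pn[i ui] := u0; have /rV0Pn[j vj] := v0.
  have vi : w.2 0 i = 0 by move/eqP: (z i); rewrite mulf_eq0 (negbTE ui) => /eqP.
  have uj : w.1 0 j = 0 by move/eqP: (z j); rewrite mulf_eq0 (negbTE vj) orbF => /eqP.
  have ij : i != j by apply: contraNneq ui => ->; rewrite uj.
  exists (i, j) => //.
  by move: ij; clear; move: i j => [[|[|[|//]]] ?] [[|[|[|//]]] ?].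
nia.
Qed.


Definition fnorm (f : 'I_3 -> int) : nat := \max_k absz (f k).

Lemma leq_fnorm (f : 'I_3 -> int) k : (absz (f k) <= fnorm f)%N.
Proof. exact: leq_bigmax. Qed.

Lemma fnorm_leq (f : 'I_3 -> int) n :
  (forall k, (absz (f k) <= n)%N) -> (fnorm f <= n)%N.
Proof. by move=> fn; apply/bigmax_leqP. Qed.

Lemma fnorm_witness (f : 'I_3 -> int) : exists k, absz (f k) = fnorm f.
Proof. by have [|k e] := @bigop.eq_bigmax 'I_3 (fun k => absz (f k)); [rewrite card_ord | exists k]. Qed.

Lemma fnorm_gt0 (u : 'rV[int]_3) : u != 0 -> (0 < fnorm (u 0%R))%N.
Proof.
by case/rV0Pn=> i ui; apply: leq_trans (leq_fnorm _ i); rewrite absz_gt0.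
Qed.

Definition orth_bounded (t : nat) (w : 'rV[int]_3 * 'rV[int]_3) : Prop :=
  [/\ w.1 != 0, w.2 != 0, \sum_k w.1 0 k * w.2 0 k = 0 &
      (fnorm (w.1 0%R) * fnorm (w.2 0%R) <= t)%N].

(* Dyadic decomposition according to the norm of the first vector. *)
Lemma covered_orth_bounded (t L N : nat) : (t < 2 ^ L)%N -> (4 * t <= N)%N ->
  covered (orth_bounded t) (L * (972 * (2 * t) ^ 2 * maxdiv N)).
Proof.
move=> tL tN.
have H (i : nat) : covered (orth_pair (2 ^ i.+1) (t %/ 2 ^ i)) (972 * (2 * t) ^ 2 * maxdiv N).
  have [b0|b0] := posnP (t %/ 2 ^ i)%N.
    apply: covered0 => w [_ /rV0Pn[k /negP wk] _ _ /(_ k)].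
    by rewrite b0 leqn0 absz_eq0.
  (* On the scale [2 ^ i <= |u| < 2 ^ (i + 1)] the second vector has norm at most [t / 2 ^ i], so
     the product of the two box sizes loses only a factor 2 against [t]. *)
  have ab : (2 ^ i.+1 * (t %/ 2 ^ i) <= 2 * t)%N.
    by rewrite expnS -mulnA leq_mul2l /= mulnC leq_divM.
  have a0 : (0 < 2 ^ i.+1)%N by rewrite expn_gt0.
  have abN : (2 * (2 ^ i.+1 * (t %/ 2 ^ i)) <= N)%N by lia.
  apply: (covered_sub (covered_orth_pair a0 b0 abN)) => //.
  by rewrite leq_mul2r leq_mul2l leq_exp2r // ab !orbT.
apply: (covered_sub (covered_bigU (s := iota 0 L) (n := L) _ (fun i _ => H i))) => //.
  by rewrite size_iota.
move=> w [u0 v0 uv wt]; have := fnorm_gt0 u0; have := fnorm_gt0 v0.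
move: wt; set a := fnorm _; set b := fnorm _ => abt b0 a0.
have /andP[la ua] := @trunc_log_bounds 2 a isT a0.
exists (trunc_log 2 a).
  rewrite mem_iota /= add0n -(ltn_exp2l _ _ (isT : (1 < 2)%N)).
  apply: leq_ltn_trans tL; apply: leq_trans la _.
  by apply: leq_trans abt; rewrite leq_pmulr.
split=> // k; first by apply: leq_trans (ltnW ua); apply: leq_fnorm.
apply: leq_trans (leq_fnorm _ k) _; rewrite -/b leq_divRL ?expn_gt0 //.
by apply: leq_trans abt; rewrite mulnC leq_mul2r la orbT.
Qed.

(** * Matrices with bounded product of norms *)

Definition dominant (i : 'I_3) (F : 'I_3 -> 'I_3 -> int) : Prop :=
  forall m, (fnorm (F m) <= fnorm (F i))%N.

Lemma dominant_exists (F : 'I_3 -> 'I_3 -> int) : exists i, dominant i F.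
Proof.
have [i _ Hi] := @arg_maxnP _ 0 predT (fun m => fnorm (F m)) isT.
by exists i => m; apply: Hi.
Qed.

(** The transpose turns columns of the inverse into rows. The condition [i != j] is what makes row
    [i] of [A] orthogonal to column [j] of the inverse. *)
Definition dominant_pair (t : nat) (i j : 'I_3) (A : 'M[int]_3) : Prop :=
  [/\ A \in unitmx, i != j, dominant i A, dominant j (invmx A)^T &
     (fnorm (A i) * fnorm ((invmx A)^T j) <= t)%N].

Lemma col_mulmx (V : pzRingType) m n p (A : 'M[V]_(m, n)) (B : 'M[V]_(n, p)) j :
  col j (A *m B) = A *m col j B.
Proof. by rewrite !colE mulmxA. Qed.

Lemma absz_quotient_leq (n u : int) (c : nat) :
  u != 0 -> (absz (n * u)%R <= c * absz u)%N -> (absz n <= c)%N.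
Proof. by move=> u0; rewrite abszM leq_pmul2r // absz_gt0. Qed.

Lemma absz_add_leq (x y : int) (b c : nat) :
  (absz x <= b)%N -> (absz y <= c)%N -> (absz (x + y)%R <= b + c)%N.
Proof. lia. Qed.

Lemma absz_addend_leq (x n m : int) (b c : nat) :
  x = n + m -> (absz x <= b)%N -> (absz m <= c)%N -> (absz n <= b + c)%N.
Proof. lia. Qed.

Lemma covered_dominant_fiber (t : nat) (i j : 'I_3) (u v : 'rV[int]_3) :
  covered (fun A => dominant_pair t i j A /\ (row i A, row j (invmx A)^T) = (u, v)) (5 * 5 * (9 * 3)).
Proof.
set P := (P in covered P).
have [[A' PA']|nP] := pselect (exists A, P A); last first.
  by apply: covered0 => A PA; apply: nP; exists A.
(* [f A] has row [i] equal to [e_i] and column [j] equal to [e_j]; maximality of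
   [u] and [v] bounds its four other entries. *)
pose f (A : 'M[int]_3) := A *m invmx A'.
have [[uA' ij dA' dB' _] [ru' rv']] := PA'.
have [k ijk] := ord3_third ij.
have ik : i != k by move: ijk; rewrite /= !inE negb_or => /andP[/andP[]].
have jk : j != k by move: ijk; rewrite /= !inE => /andP[_ /andP[]].
have fK A : A = f A *m A' by rewrite mulmxKV.
have rowi (A B : 'M[int]_3) : A \in unitmx -> row i A = row i B -> forall x, (B *m invmx A) i x = (i == x)%:R.
  move=> uA rAB x; have : row i (B *m invmx A) = row i 1%:M.
    by rewrite row_mul -rAB -row_mul mulmxV.
  by move/rowP/(_ x); rewrite !mxE.
have colj (A B : 'M[int]_3) : A \in unitmx -> row j (invmx A)^T = row j (invmx B)^T ->
    forall x, (A *m invmx B) x j = (x == j)%:R.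
  move=> uA rAB x; have : col j (A *m invmx B) = col j 1%:M.
    rewrite col_mulmx; suff <- : col j (invmx A) = col j (invmx B).
      by rewrite -col_mulmx mulmxV.
    by apply/colP => y; move/rowP/(_ y): rAB; rewrite !mxE.
  by move/colP/(_ x); rewrite !mxE.
have Fi A : P A -> forall x, f A i x = (i == x)%:R.
  by move=> [[uA _ _ _ _] [ru rv]]; apply: rowi; rewrite // ru ru'.
have Fj A : P A -> forall x, f A x j = (x == j)%:R.
  by move=> [[uA _ _ _ _] [ru rv]]; apply: colj; rewrite // rv rv'.
have [x ux] := fnorm_witness (u 0); have [y vy] := fnorm_witness (v 0).
have du A : P A -> forall m, (absz (A m x) <= absz (u 0%R x))%N.
  move=> [[_ _ dA _ _] [ru _]] m; rewrite ux.
  apply: leq_trans (leq_fnorm (A m) x) _; apply: leq_trans (dA m) _.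
  by rewrite -ru; apply: fnorm_leq => z; apply: leq_trans (leq_fnorm _ z); rewrite mxE.
have dv A : P A -> forall m, (absz (invmx A y m) <= absz (v 0%R y))%N.
  move=> [[_ _ _ dB _] [_ rv]] m; rewrite vy.
  have -> : invmx A y m = (invmx A)^T m y by rewrite mxE.
  apply: leq_trans (leq_fnorm ((invmx A)^T m) y) _; apply: leq_trans (dB m) _.
  by rewrite -rv; apply: fnorm_leq => z; apply: leq_trans (leq_fnorm _ z); rewrite !mxE.
have ux0 : u 0 x != 0.
  apply/eqP => u0; have : row i (A' *m invmx A') = row i 1%:M by rewrite mulmxV.
  rewrite row_mul ru'; suff -> : u = 0.
    by rewrite mul0mx => /rowP /(_ i); rewrite !mxE eqxx.
  by apply/rowP => z; apply/eqP; rewrite mxE -absz_eq0 -leqn0; apply: leq_trans (leq_fnorm _ z) _; rewrite -ux u0.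
have vy0 : v 0 y != 0.
  apply/eqP => v0; have : col j (A' *m invmx A') = col j 1%:M by rewrite mulmxV.
  rewrite col_mulmx; suff -> : col j (invmx A') = 0.
    by rewrite mulmx0 => /colP /(_ j); rewrite !mxE eqxx.
  have vz : v = 0.
    by apply/rowP => z; apply/eqP; rewrite mxE -absz_eq0 -leqn0; apply: leq_trans (leq_fnorm _ z) _; rewrite -vy v0.
  by apply/colP => z; move/rowP/(_ z): rv'; rewrite vz !mxE.
(* The inverse of [f A] also has row [i] equal to [e_i], so the entry [(k, k)] of the product of the
   two is the product of their entries [(k, k)]; it equals 1, hence both are units. *)
have Nkk A : P A -> (absz (f A k k) <= 1)%N.
  move=> PA; have [[uA _ _ _ _] [ru rv]] := PA.
  have e : f A *m (A' *m invmx A) = 1%:M by rewrite mulmxA -fK mulmxV.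
  have : (f A *m (A' *m invmx A)) k k = 1 by rewrite e mxE eqxx.
  rewrite mxE (ord3_sum _ ijk) Fj // (rowi A A') ?ru ?ru' //.
  rewrite [k == j]eq_sym (negbTE ik) (negbTE jk) mulr0 mul0r !add0r => /(congr1 absz)/eqP.
  by rewrite abszM muln_eq1 => /andP[/eqP-> _].
(* In the column [x] where [u] attains its norm, [A k x = f_ki * u_x + f_kk * A' k x]. Neither
   [A k x] nor [A' k x] exceeds [u_x] in absolute value, so [f_ki] is at most [1 + 1]. *)
have Nki A : P A -> (absz (f A k i) <= 2)%N.
  move=> PA; have [_ [ru rv]] := PA.
  have : A k x = (f A *m A') k x by rewrite -fK.
  rewrite mxE (ord3_sum _ ijk) Fj // [k == j]eq_sym (negbTE jk) mul0r addr0.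
  have -> : A' i x = u 0 x by rewrite -ru' mxE.
  have h : (absz (f A k k * A' k x)%R <= 1 * absz (u 0%R x))%N.
    by rewrite abszM leq_mul ?Nkk // du.
  move=> e; apply: (absz_quotient_leq ux0).
  rewrite -[2%N]/(1 + 1)%N mulnDl; apply: (absz_addend_leq e) h.
  by rewrite mul1n du.
(* The same argument for [invmx A' = invmx A *m f A], in the row [y] where [v] attains its norm. *)
have Njk A : P A -> (absz (f A j k) <= 2)%N.
  move=> PA; have [[uA _ _ _ _] [ru rv]] := PA.
  have : invmx A' y k = (invmx A *m f A) y k by rewrite mulKmx.
  rewrite mxE (ord3_sum _ ijk) Fi // (negbTE ik) mulr0 add0r.
  have -> : invmx A y j = v 0 y by rewrite -rv !mxE.
  have h : (absz (invmx A y k * f A k k)%R <= 1 * absz (v 0%R y))%N.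
    by rewrite abszM mulnC leq_mul ?Nkk // dv.
  move=> e; apply: (absz_quotient_leq vy0).
  rewrite -[2%N]/(1 + 1)%N mulnDl; apply: (absz_addend_leq (x := invmx A' y k) _ _ h).
    by rewrite e mulrC.
  by rewrite mul1n dv.
(* Column [x] again, now with three known terms, of sizes 1, 1 and 2 relative to [u_x]. *)
have Nji A : P A -> (absz (f A j i) <= 4)%N.
  move=> PA; have [[uA _ _ _ _] [ru rv]] := PA.
  have : A j x = (f A *m A') j x by rewrite -fK.
  rewrite mxE (ord3_sum _ ijk) Fj // eqxx mul1r.
  have -> : A' i x = u 0 x by rewrite -ru' mxE.
  have h : (absz (f A j k * A' k x)%R <= 2 * absz (u 0%R x))%N.
    by rewrite abszM leq_mul ?Njk // du.
  rewrite -addrA => e; apply: (absz_quotient_leq ux0).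
  rewrite -[4%N]/(1 + 3)%N mulnDl; apply: (absz_addend_leq e).
    by rewrite mul1n du.
  by rewrite -[3%N]/(1 + 2)%N mulnDl; apply: absz_add_leq; rewrite // mul1n du.
have C := coveredX (coveredX (covered_box 2) (covered_box 2)) (coveredX (covered_box 4) (covered_box 1)).
apply: (covered_inj (f := fun A => ((f A k i, f A j k), (f A j i, f A k k))) C) => /=.
  by move=> A PA; rewrite Nki // Njk // Nji // Nkk.
move=> A1 A2 P1 P2 [e1 e2 e3 e4].
rewrite (fK A1) (fK A2); congr (_ *m _); apply/matrixP => a b; move: a.
apply: (ord3_ind (P := fun a => f A1 a b = f A2 a b) ijk); first by rewrite !Fi.
  by apply: (ord3_ind (P := fun b => f A1 j b = f A2 j b) ijk) => //; rewrite !Fj.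
by apply: (ord3_ind (P := fun b => f A1 k b = f A2 k b) ijk) => //; rewrite !Fj.
Qed.

Definition mnorm (A : 'M[int]_3) : nat := \max_i fnorm (A i).

Lemma leq_mnorm (A : 'M[int]_3) i : (fnorm (A i) <= mnorm A)%N.
Proof. exact: leq_bigmax. Qed.

Lemma covered_dominant_pair (t L N : nat) (i j : 'I_3) : (t < 2 ^ L)%N -> (4 * t <= N)%N ->
  covered (dominant_pair t i j) (L * (972 * (2 * t) ^ 2 * maxdiv N) * (5 * 5 * (9 * 3))).
Proof.
move=> tL tN.
apply: (covered_fiber (f := fun A => (row i A, row j (invmx A)^T)) (covered_orth_bounded tL tN)).
  move=> A [uA ij _ _ At].
  have AB : A *m invmx A = 1%:M by rewrite mulmxV.
  split=> /=.
  - apply/eqP => u0; have := congr1 (row i) AB.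
    by rewrite row_mul u0 mul0mx => /rowP/(_ i); rewrite !mxE eqxx.
  - apply/eqP => v0; have := congr1 (col j) AB.
    rewrite col_mulmx -[invmx A]trmxK -tr_row v0 trmx0 mulmx0 => /colP/(_ j).
    by rewrite !mxE eqxx.
  - have := congr1 (fun M : 'M[int]_3 => M i j) AB; rewrite !mxE (negbTE ij) => e.
    by rewrite -[RHS]e; apply: eq_bigr => k _; rewrite !mxE.
  - apply: leq_trans At; apply: leq_mul; apply: fnorm_leq => k.
      by rewrite mxE leq_fnorm.
    by rewrite mxE leq_fnorm.
by move=> [u v] _; apply: covered_dominant_fiber.
Qed.

Definition bounded_pair (t : nat) (A : 'M[int]_3) : Prop :=
  A \in unitmx /\ (mnorm A * mnorm (invmx A) <= t)%N.

Definition elem_mx (s : int) (l i : 'I_3) : 'M[int]_3 := 1%:M + s *: delta_mx l i.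

Lemma elem_mxK (s : int) (l i : 'I_3) : i != l -> elem_mx s l i *m elem_mx (- s) l i = 1%:M.
Proof.
move=> il; rewrite /elem_mx mulmxDl mul1mx mulmxDr mulmx1 -scalemxAl -scalemxAr.
rewrite mul_delta_mx_0 // !scaler0 addr0 scaleNr.
by rewrite -addrA addNr addr0.
Qed.

Lemma elem_mxE (s : int) (l i : 'I_3) (A : 'M[int]_3) m x :
  (elem_mx s l i *m A) m x = A m x + s * (m == l)%:R * A i x.
Proof.
rewrite mulmxDl mul1mx mxE; congr (_ + _).
rewrite -scalemxAl mxE -mulrA; congr (_ * _).
rewrite mxE (bigD1 i) //= big1 ?addr0 ?mxE ?eqxx ?andbT // => k ki.
by rewrite mxE (negbTE ki) andbF mul0r.
Qed.

Lemma mul_elem_mxE (s : int) (l i : 'I_3) (A : 'M[int]_3) x m :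
  (A *m elem_mx s l i) x m = A x m + s * (m == i)%:R * A x l.
Proof.
rewrite mulmxDr mulmx1 mxE; congr (_ + _).
rewrite -scalemxAr mxE -mulrA; congr (_ * _).
rewrite mxE (bigD1 l) //= big1 ?addr0 ?mxE ?eqxx /= 1?mulrC // => k ki.
by rewrite mxE (negbTE ki) mulr0.
Qed.

(** The second case arises when the largest row of [A] and the largest column of its inverse have
    the same index. The factor 9 appears because the new row and the new column are each at most
    three times the old ones. *)
Lemma bounded_pair_dominant (t : nat) (A : 'M[int]_3) : bounded_pair t A ->
  (exists i j, dominant_pair t i j A) \/
  exists i l s, s \in [:: 2; -2 : int] /\ dominant_pair (9 * t) l i (elem_mx s l i *m A).
Proof.
move=> [uA At]; set B := invmx A in At.
have [i di] := dominant_exists A; have [j dj] := dominant_exists B^T.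
have rB x m : B x m = B^T m x by rewrite mxE.
have fi : (fnorm (A i) <= mnorm A)%N by apply: leq_mnorm.
have fj : (fnorm (B^T j) <= mnorm B)%N.
  by apply: fnorm_leq => k; rewrite mxE; apply: leq_trans (leq_mnorm _ k); apply: leq_fnorm.
have ABt : (fnorm (A i) * fnorm (B^T j) <= t)%N by apply: leq_trans At; apply: leq_mul.
have [ij|ij] := eqVneq i j; last first.
  by left; exists i, j; split.
right; rewrite {}ij in di fi ABt; move: j di fi dj fj ABt => {}i di fi dj fj ABt.
have [l il] : exists l, i != l by exists (i + 1); move: i {di fi dj fj ABt} => [[|[|[|//]]] ?].
have [y yB] := fnorm_witness (B^T i).
have [x xA] := fnorm_witness (A i).
(* Adding [s] times row [i] to row [l] of [A] subtracts [s] times column [l] from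
   column [i] of [B]; with [|s| = 2] the new row is dominant for either sign, and
   the new column for at least one of them. *)
have [s s2 sB] : exists2 s, s \in [:: 2; -2 : int] & (absz (B^T i y) <= absz (B^T i y - s * B^T l y)%R)%N.
  (* The values for [s = 2] and [s = -2] average to [B^T i y], so they cannot both be smaller than
     it in absolute value. *)
  have [h|h] := leqP (absz (B^T i y)) (absz (B^T i y - 2 * B^T l y)%R).
    by exists 2.
  by exists (- 2) => //; move: h; lia.
have s2' : absz s = 2%N by move: s2; rewrite !inE => /orP[] /eqP ->.
exists i, l, s; split=> //; set A1 := _ *m A.
have uE : elem_mx s l i \in unitmx by have [] := mulmx1_unit (elem_mxK s il).
have uA1 : A1 \in unitmx by rewrite unitmx_mul uE.
have B1E : invmx A1 = B *m elem_mx (- s) l i.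
  rewrite -[RHS](mulmxK uA1) -[B *m _ *m _]mulmxA [elem_mx _ _ _ *m A1]mulmxA.
  have := elem_mxK (- s) il; rewrite opprK => ->.
  by rewrite mul1mx mulVmx // mul1mx.
have A1l : fnorm (A1 l) = fnorm (fun x => A l x + s * A i x).
  by apply: eq_bigr => k _; rewrite elem_mxE eqxx mulr1.
have A1m m : m != l -> fnorm (A1 m) = fnorm (A m).
  by move=> ml; apply: eq_bigr => k _; rewrite elem_mxE (negbTE ml) mulr0 mul0r addr0.
have tB m z : (invmx A1)^T m z = B z m + - s * (m == i)%:R * B z l.
  by rewrite mxE B1E mul_elem_mxE.
have B1i : fnorm ((invmx A1)^T i) = fnorm (fun x => B^T i x - s * B^T l x).
  by apply: eq_bigr => k _; rewrite tB eqxx mulr1 mulNr -!rB.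
have B1m m : m != i -> fnorm ((invmx A1)^T m) = fnorm (B^T m).
  by move=> mi; apply: eq_bigr => k _; rewrite tB (negbTE mi) mulr0 mul0r addr0 rB.
(* At the position [x] of the maximum, the new entry is at least
   [2 |A i x| - |A l x| >= |A i x|]. *)
have geA : (fnorm (A i) <= fnorm (A1 l))%N.
  rewrite A1l; apply: leq_trans (leq_fnorm (fun x => A l x + s * A i x) x) => /=.
  have := leq_trans (leq_fnorm (A l) x) (di l).
  rewrite -xA; move: s2; rewrite !inE => /orP[] /eqP -> ; lia.
have geB : (fnorm (B^T i) <= fnorm ((invmx A1)^T i))%N.
  rewrite B1i -yB; apply: leq_trans sB _.
  exact: (leq_fnorm (fun x => B^T i x - s * B^T l x)).
have leA : (fnorm (A1 l) <= 3 * fnorm (A i))%N.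
  rewrite A1l; apply: fnorm_leq => k.
  have := leq_trans (leq_fnorm (A l) k) (di l); have := leq_fnorm (A i) k.
  move: s2; rewrite !inE => /orP[] /eqP -> ; lia.
have leB : (fnorm ((invmx A1)^T i) <= 3 * fnorm (B^T i))%N.
  rewrite B1i; apply: fnorm_leq => k.
  have := leq_trans (leq_fnorm (B^T l) k) (dj l); have := leq_fnorm (B^T i) k.
  move: s2; rewrite !inE => /orP[] /eqP -> ; lia.
split=> //; first by rewrite eq_sym.
- by move=> m; have [->//|ml] := eqVneq m l; rewrite A1m //; apply: leq_trans geA.
- by move=> m; have [->//|ml] := eqVneq m i; rewrite B1m //; apply: leq_trans geB.
- by apply: leq_trans (leq_mul leA leB) _; rewrite mulnACA leq_mul2l ABt.
Qed.

Lemma covered_bounded_pair : exists K, forall t L N : nat,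
  (9 * t < 2 ^ L)%N -> (36 * t <= N)%N ->
  covered (bounded_pair t) (K * (L * t ^ 2 * maxdiv N)).
Proof.
(* The numeral is hidden behind a variable, so that the arithmetic treats it as an atom. *)
have [c c0] : {c | c = 972%N} by exists 972.
pose M := (5 * 5 * (9 * 3))%N.
(* There are 9 index pairs in each case; [4] comes from [(2 * t) ^ 2], [4 * 81] from
   [(2 * (9 * t)) ^ 2], and the inner factor 2 from the sign of [s]. *)
exists (9 * (4 * c * M) + 9 * (2 * (4 * 81 * c * M)))%N => t L N tL tN.
have C1 (ij : 'I_3 * 'I_3) : covered (dominant_pair t ij.1 ij.2) (L * (c * (2 * t) ^ 2 * maxdiv N) * M).
  by rewrite c0; apply: covered_dominant_pair; lia.
have C2 (il : 'I_3 * 'I_3) : covered (fun A => exists2 s, s \in [:: 2; -2 : int] &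
    dominant_pair (9 * t) il.2 il.1 (elem_mx s il.2 il.1 *m A)) (2 * (L * (c * (2 * (9 * t)) ^ 2 * maxdiv N) * M)).
  apply: covered_bigU => // s _.
  have [e|ne] := eqVneq il.1 il.2.
    by apply: covered0 => A [_ + _ _ _]; rewrite e eqxx.
  have C : covered (dominant_pair (9 * t) il.2 il.1) (L * (c * (2 * (9 * t)) ^ 2 * maxdiv N) * M).
    by rewrite c0; apply: covered_dominant_pair; lia.
  apply: (covered_inj (f := mulmx (elem_mx s il.2 il.1)) C) => // A A' _ _ e.
  have := elem_mxK (- s) ne; rewrite opprK => E.
  by rewrite -[A]mul1mx -[A']mul1mx -E -!mulmxA e.
have D1 := covered_bigU (s := enum {: 'I_3 * 'I_3}) (n := 9) _ (fun u _ => C1 u).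
have D2 := covered_bigU (s := enum {: 'I_3 * 'I_3}) (n := 9) _ (fun u _ => C2 u).
have s9 : (size (enum {: 'I_3 * 'I_3}) <= 9)%N by rewrite -cardE card_prod card_ord.
apply: (covered_sub (coveredU (D1 s9) (D2 s9))).
  move=> A /bounded_pair_dominant[[i [j Gij]]|[i [l [s [s2 Gs]]]]].
    by left; exists (i, j); rewrite ?mem_enum.
  by right; exists (i, l); rewrite ?mem_enum //; exists s.
apply/eq_leq; move: (maxdiv N) => D; ring.
Qed.


(** * Matrices congruent to a scalar plus a rank one matrix *)

Lemma ord3_ind012 (P : 'I_3 -> Prop) : P 0 -> P 1 -> P 2 -> forall i, P i.
Proof. exact: ord3_ind. Qed.

Lemma det3E (V : comNzRingType) (A : 'M[V]_3) (i j k : 'I_3) : uniq [:: i; j; k] ->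
  \det A = A i i * (A j j * A k k - A j k * A k j)
         - A i j * (A j i * A k k - A j k * A k i)
         + A i k * (A j i * A k j - A j j * A k i).
Proof.
have E012 : \det A = A 0 0 * (A 1 1 * A 2 2 - A 1 2 * A 2 1)
         - A 0 1 * (A 1 0 * A 2 2 - A 1 2 * A 2 0)
         + A 0 2 * (A 1 0 * A 2 1 - A 1 1 * A 2 0).
  pose a m n := A (inord m) (inord n).
  have Ea m n : A m n = a m n by rewrite /a !inord_val.
  rewrite (expand_det_row _ 0) !big_ord_recl big_ord0 /cofactor.
  rewrite !(expand_det_row _ ord0) !big_ord_recl !big_ord0 /cofactor !det_mx11 !mxE !Ea /=.
  rewrite -[(1 %% 3)%N]/1%N -[(2 %% 3)%N]/2%N; ring.
move: i j k; apply: ord3_ind012 => j k; move: j k; apply: ord3_ind012 => k;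
  move: k; apply: ord3_ind012 => //= _; rewrite E012; ring.
Qed.

Lemma invmx3_diag (A : 'M[int]_3) (i j k : 'I_3) : uniq [:: i; j; k] ->
  \det A = 1 -> invmx A k k = A i i * A j j - A i j * A j i.
Proof.
move=> ijk dA; have uA : A \in unitmx by rewrite unitmxE dA unitr1.
have ik : (i == k) = false by move: ijk; rewrite /= !inE negb_or => /andP[/andP[_ /negbTE]].
have jk : (j == k) = false by move: ijk; rewrite /= !inE => /andP[_ /andP[/negbTE]].
have E m : (A *m invmx A) m k = (m == k)%:R by rewrite mulmxV // mxE.
have := E i; have := E j; have := E k; move: dA.
rewrite (det3E _ ijk) !mxE !(ord3_sum _ ijk) ik jk eqxx /=.
set B := invmx A => dA ek ej ei.
rewrite -[LHS]mul1r -{1}dA.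
apply/eqP; rewrite -subr_eq0; apply/eqP.
(* The equations for column [k] of [A *m B = 1] are combined with the cofactors of column [k] of [A]
   as coefficients. *)
transitivity ((A j i * A k j - A j j * A k i) * (A i i * B i k + A i j * B j k + A i k * B k k)
   - (A i i * A k j - A i j * A k i) * (A j i * B i k + A j j * B j k + A j k * B k k)
   + (A i i * A j j - A i j * A j i) * (A k i * B i k + A k j * B j k + A k k * B k k - 1)); first by ring.
by rewrite ek ej ei; ring.
Qed.

Definition rank_one_shift (V : comNzRingType) (A : 'M[int]_3) (l : V) (x y : 'I_3 -> V) :=
  forall i j, (A i j)%:~R = l *+ (i == j) + x i * y j.

Section RankOneShift.
Variables (V : comNzRingType) (A : 'M[int]_3) (l : V) (x y : 'I_3 -> V).
Hypothesis H : rank_one_shift A l x y.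

(** The terms [x i * y i * x j * y j] cancel, so a principal minor depends only on [l] and the
    diagonal. By [invmx3_diag] this fixes the diagonal of the inverse modulo [q]. *)
Lemma rank_one_minor (i j : 'I_3) : i != j ->
  (A i i * A j j - A i j * A j i)%:~R
  = l * ((A i i)%:~R + (A j j)%:~R) - l ^+ 2 :> V.
Proof.
move=> ij; rewrite rmorphB !rmorphM /= !H !eqxx [j == i]eq_sym (negbTE ij) !mulr1n !mulr0n; ring.
Qed.

(** The determinant is [l ^ 3 + l ^ 2 * s] and the trace is [3 * l + s], where [s] is the sum of the
    [x m * y m]. For determinant 1 this is a polynomial equation for [l] once the diagonal is
    known. *)
Lemma rank_one_det (i j k : 'I_3) : uniq [:: i; j; k] ->
  (\det A)%:~R
  = l ^+ 2 * ((A i i)%:~R + (A j j)%:~R + (A k k)%:~R) - 2 * l ^+ 3 :> V.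
Proof.
move=> ijk; rewrite (det3E _ ijk).
have [ij ik jk] : [/\ i != j, i != k & j != k].
  by move: ijk; rewrite /= !inE negb_or => /and3P[/andP[-> ->] -> _].
rewrite !(rmorphD, rmorphN, rmorphM) /= !H !eqxx.
have [ji ki kj] : [/\ j != i, k != i & k != j] by rewrite ![_ == i]eq_sym [k == j]eq_sym.
rewrite ?(negbTE ij, negbTE ik, negbTE jk, negbTE ji, negbTE ki, negbTE kj) !mulr1n !mulr0n; ring.
Qed.

Lemma rank_one_shift_tr : rank_one_shift A^T l y x.
Proof. by move=> i j; rewrite mxE H eq_sym mulrC. Qed.

End RankOneShift.

Lemma intr_Fp_eq0 (q : nat) (z : int) : prime q ->
  z%:~R = 0 :> 'F_q -> (absz z < q)%N -> z = 0.
Proof.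
move=> pq /eqP; rewrite -(dvdz_pcharf (pchar_Fp pq)) /dvdz => dz zq.
by apply/eqP; rewrite -absz_eq0; apply: contraTT zq => z0; rewrite -leqNgt dvdn_leq // lt0n.
Qed.

Lemma intr_Fp_inj (q : nat) (z w : int) : prime q ->
  z%:~R = w%:~R :> 'F_q -> (absz (z - w)%R < q)%N -> z = w.
Proof.
move=> pq zw lt; apply/eqP; rewrite -subr_eq0; apply/eqP.
by apply: (intr_Fp_eq0 pq) lt; rewrite rmorphB /= zw subrr.
Qed.

(** After a shift by [b] the candidates lie between 0 and [2 * b], where members of one residue
    class have distinct quotients by [q]. *)
Lemma covered_residue (q b : nat) (c : 'F_q) : prime q ->
  covered (fun z : int => (absz z <= b)%N /\ z%:~R = c) (b.*2 %/ q).+1%N.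
Proof.
move=> pq; have q0 := prime_gt0 pq.
have C : covered (fun n => n < (b.*2 %/ q).+1)%N (b.*2 %/ q).+1.
  by exists (iota 0 (b.*2 %/ q).+1); rewrite ?size_iota // => n; rewrite mem_iota.
refine (covered_inj (f := fun z : int => (absz (z + b%:Z)%R %/ q)%N) C _ _).
  by move=> z [zb _]; rewrite ltnS leq_div2r //; lia.
move=> z w [zb zc] [wb wc] e; apply: (intr_Fp_inj pq); first by rewrite zc wc.
have := divn_eq (absz (z + b%:Z)%R) q; have := divn_eq (absz (w + b%:Z)%R) q.
rewrite e; have := ltn_pmod (absz (z + b%:Z)%R) q0; have := ltn_pmod (absz (w + b%:Z)%R) q0.
set r := (_ %% q)%N; set s := (_ %% q)%N; set t := (_ * q)%N; lia.
Qed.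

Definition small_unimodular (a : nat) (A : 'M[int]_3) : Prop :=
  \det A = 1 /\ forall i j, (absz (A i j) <= a)%N.

Lemma int_mul_eq1 (u m : int) : u * m = 1 -> u = m.
Proof.
move=> um; have /eqP := congr1 absz um; rewrite abszM muln_eq1 => /andP[u1 _].
have [e|e] : u = 1 \/ u = -1 by lia.
  by move: um; rewrite e mul1r.
by move: um; rewrite e mulN1r => /(congr1 -%R); rewrite opprK.
Qed.

(** * Degenerate rank one shifts, where a coordinate of [x] vanishes *)

Section DegenerateCount.
Variables (q a : nat).
Hypotheses (pq : prime q) (a0 : (0 < a)%N) (aq : (4 * a < q)%N).

(* [x i = 0] forces row [i] of [A] to vanish off the diagonal, as [a < q]. *)
Let degenerate (i : 'I_3) (A : 'M[int]_3) : Prop := small_unimodular a A /\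
  exists (l : 'F_q) x y, rank_one_shift A l x y /\ x i = 0.

(** Row [i] is [A i i] times [e_i], so [l = A i i] modulo [q], and determinant 1 makes [A i i] and
    the complementary minor the same unit. The relation between diagonal entries is [rank_one_minor]
    multiplied by this unit; it lifts to the integers because [3 * a + 1 < q]. In the last one, both
    sides are [x j * y i * x k * y k]. *)
Lemma degenerate_facts (i j k : 'I_3) (A : 'M[int]_3) : uniq [:: i; j; k] -> degenerate i A ->
  [/\ A i j = 0 /\ A i k = 0, A i i ^+ 2 = 1,
      A j j * A k k - A j k * A k j = A i i, A j j + A k k = 1 + A i i &
      (A k i * A j k)%:~R = (A j i * (A k k - A i i))%:~R :> 'F_q].
Proof.
move=> ijk [[dA sA] [l [x [y [H xi]]]]].
have [ij ik jk] : [/\ i != j, i != k & j != k].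
  by move: ijk; rewrite /= !inE negb_or => /and3P[/andP[-> ->] -> _].
have z m : i != m -> A i m = 0.
  move=> im; apply: (intr_Fp_eq0 pq); first by rewrite H (negbTE im) xi mul0r addr0.
  by have := sA i m; lia.
have Aij := z j ij; have Aik := z k ik.
have lE : (A i i)%:~R = l by rewrite H eqxx xi mul0r addr0.
have := dA; rewrite (det3E _ ijk) Aij Aik !mul0r subr0 addr0 => e.
have mE : A j j * A k k - A j k * A k j = A i i.
  by rewrite -(int_mul_eq1 e).
rewrite mE in e.
split=> //.
  apply: (intr_Fp_inj pq); last by have := sA j j; have := sA k k; have := sA i i; lia.
  have := rank_one_minor H jk; rewrite mE -lE -rmorphD /= => h.
  have h2 : ((A i i) * (A j j + A k k) - A i i ^+ 2)%:~R = (A i i)%:~R :> 'F_q.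
    by rewrite h rmorphB rmorphM rmorphXn.
  have := congr1 (fun t => (A i i)%:~R * t) h2; rewrite -!rmorphM /= => h3.
  transitivity ((A i i * (A i i * (A j j + A k k) - A i i ^+ 2) + A i i)%:~R : 'F_q).
    congr (_ %:~R); rewrite expr2 e mulrBr mulrA e; ring.
  by rewrite rmorphD /= h3 -rmorphD /= e.
rewrite !rmorphM rmorphB /= lE !H eqxx [k == i]eq_sym [j == i]eq_sym.
rewrite (negbTE ij) (negbTE ik) (negbTE jk) !mulr1n !mulr0n; ring.
Qed.

(** The sign [A i i] and the entries [A j j], [A j k], [A j i] determine the rest: [A k k] by the
    diagonal relation, [A k j] by the minor, and [A k i] by the congruence, where [A j k] is
    invertible modulo [q]. *)
Lemma covered_degenerate_offdiag (i j k : 'I_3) : uniq [:: i; j; k] ->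
  covered (fun A => degenerate i A /\ A j k != 0) (81 * a ^ 3).
Proof.
move=> ijk; have Ha := covered_box3 a0.
have C := coveredX (coveredX (covered_box 1) Ha) (coveredX Ha Ha).
have C' : covered (fun A => degenerate i A /\ A j k != 0) (3 * (3 * a) * ((3 * a) * (3 * a))).
  apply: (covered_inj (f := fun A : 'M[int]_3 => ((A i i, A j j), (A j k, A j i))) C) => /=.
    move=> A [dA _]; have [_ e _ _ _] := degenerate_facts ijk dA.
    have [[_ sA] _] := dA; rewrite !sA; split=> //; split=> //.
    by move: e; clear; nia.
  move=> A B [dA nA] [dB nB] [ei ej ejk eji].
  have [[A1 A2] A3 A4 A5 A6] := degenerate_facts ijk dA.
  have [[B1 B2] B3 B4 B5 B6] := degenerate_facts ijk dB.
  have [[_ sA] _] := dA; have [[_ sB] _] := dB.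
  have ek : A k k = B k k by apply: (@addrI _ (A j j)); rewrite A5 ej B5 ei.
  have ekj : A k j = B k j.
    apply: (mulfI nA); apply: oppr_inj; apply: (@addrI _ (A j j * A k k)).
    by rewrite A4 ei ej ek ejk B4.
  have eki : A k i = B k i.
    apply: (intr_Fp_inj pq); last by have := sA k i; have := sB k i; lia.
    have n0 : (A j k)%:~R != 0 :> 'F_q.
      apply: contra nA => /eqP e; apply/eqP/(intr_Fp_eq0 pq e).
      by have := sA j k; lia.
    apply: (mulIf n0); rewrite -rmorphM /= A6 eji ek ei -B6 -ejk.
    by rewrite rmorphM.
  apply/matrixP => x y; move: x.
  apply: (ord3_ind (P := fun x => A x y = B x y) ijk); move: y.
  - by apply: (ord3_ind ijk); rewrite ?A1 ?B1 ?A2 ?B2.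
  - by apply: (ord3_ind ijk).
  - by apply: (ord3_ind ijk).
by apply: (covered_sub C') => //; lia.
Qed.

Lemma covered_degenerate (i : 'I_3) : covered (degenerate i) (243 * a ^ 3).
Proof.
have [j ij] : exists j, i != j by exists (i + 1); move: i => [[|[|[|//]]] ?].
have [k ijk] := ord3_third ij.
have ikj : uniq [:: i; k; j].
  by move: ijk; rewrite /= !inE !negb_or [k == j]eq_sym => /and3P[/andP[-> ->] -> _].
have Ha := covered_box3 a0.
have C1 := covered_degenerate_offdiag ijk.
have C2 := covered_degenerate_offdiag ikj.
(* With both [A j k] and [A k j] zero, the entry [A k i] becomes a free parameter, but [A j k] no
   longer counts. *)
have C3 : covered (fun A : 'M[int]_3 => [/\ degenerate i A, A j k = 0 & A k j = 0]) (3 * (3 * a) * ((3 * a) * (3 * a))).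
  have C := coveredX (coveredX (covered_box 1) Ha) (coveredX Ha Ha).
  apply: (covered_inj (f := fun A : 'M[int]_3 => ((A i i, A j j), (A k i, A j i))) C) => /=.
    move=> A [dA _ _]; have [_ e _ _ _] := degenerate_facts ijk dA.
    have [[_ sA] _] := dA; rewrite !sA; split=> //; split=> //.
    by move: e; clear; nia.
  move=> A B [dA A7 A8] [dB B7 B8] [ei ej eki eji].
  have [[A1 A2] A3 A4 A5 A6] := degenerate_facts ijk dA.
  have [[B1 B2] B3 B4 B5 B6] := degenerate_facts ijk dB.
  have ek : A k k = B k k by apply: (@addrI _ (A j j)); rewrite A5 ej B5 ei.
  apply/matrixP => x y; move: x.
  apply: (ord3_ind (P := fun x => A x y = B x y) ijk); move: y.
  - by apply: (ord3_ind ijk); rewrite ?A1 ?B1 ?A2 ?B2.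
  - by apply: (ord3_ind ijk); rewrite ?A7 ?B7.
  - by apply: (ord3_ind ijk); rewrite ?A8 ?B8.
apply: (covered_sub (coveredU C1 (coveredU C2 C3))); last lia.
move=> A dA; have [e1|e1] := eqVneq (A j k) 0; last by left.
have [e2|e2] := eqVneq (A k j) 0; last by right; left.
by right; right.
Qed.

End DegenerateCount.

Lemma shifted_root_count (F : finFieldType) (t : F) :
  exists2 s : seq F, (size s <= 3)%N &
    forall l, l ^+ 2 * t - 2 * l ^+ 3 = 1 -> l \in s.
Proof.
(* The constant term 1 keeps [p] nonzero in every characteristic. *)
pose p : {poly F} := 1%:P - 'X^2 * (t%:P - 2%:P * 'X).
have pE l : p.[l] = 1 - (l ^+ 2 * t - 2 * l ^+ 3).
  rewrite !(hornerD, hornerN, hornerM, hornerXn, hornerC, hornerX); ring.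
have p0 : p != 0.
  apply/eqP => /(congr1 (fun p => p.[0])); rewrite pE horner0.
  by rewrite !expr0n /= mul0r mulr0 !subr0 => /eqP; rewrite oner_eq0.
have sp : (size p <= 4)%N.
  apply: leq_trans (size_polyD _ _) _; rewrite size_polyN geq_max (leq_trans (size_polyC_leq1 _)) //=.
  apply: leq_trans (size_polyMleq _ _) _; rewrite size_polyXn addSn /= (leq_add2l 2 _ 2).
  apply: leq_trans (size_polyD _ _) _; rewrite size_polyN geq_max.
  rewrite (leq_trans (size_polyC_leq1 _)) //=.
  apply: leq_trans (size_polyMleq _ _) _; rewrite size_polyX.
  by rewrite addnS /= addn1 ltnS size_polyC_leq1.
exists [seq l <- enum F | root p l].
  rewrite -ltnS; apply: leq_trans sp; apply: max_poly_roots => //.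
    by rewrite all_filter; apply/allP => l _; apply/implyP.
  exact/filter_uniq/enum_uniq.
by move=> l e; rewrite mem_filter mem_enum /root pE e subrr eqxx.
Qed.

(** If no off-diagonal entry vanishes, the count runs through the diagonal, then [l], then the
    principal minors, then factorizations of the products [A i j * A j i]. A zero off-diagonal entry
    gives [x i * y j = 0], so that [A] or its transpose is degenerate. *)
Lemma covered_rank_one (q a b N : nat) : prime q -> (0 < a)%N -> (4 * a < q)%N ->
  (2 * a ^ 2 <= N)%N ->
  covered (fun A : 'M[int]_3 => [/\ small_unimodular a A,
      forall k, (absz (invmx A k k) <= b)%N &
      exists (l : 'F_q) x y, rank_one_shift A l x y])
    (2106 * (a ^ 3 * (b.*2 %/ q).+1 ^ 3 * maxdiv N ^ 3)).
Proof.
move=> pq a0 aq aN; set P := (P in covered P).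
have N0 : (0 < N)%N by nia.
have D0 := maxdiv_gt0 N0.
pose nz (A : 'M[int]_3) := forall i j, i != j -> A i j != 0.
have u012 : uniq [:: 0; 1; 2 : 'I_3] by [].
have u021 : uniq [:: 0; 2; 1 : 'I_3] by [].
have u120 : uniq [:: 1; 2; 0 : 'I_3] by [].
have aa (z w : int) : (absz z <= a)%N -> (absz w <= a)%N -> (absz (z * w)%R <= a ^ 2)%N.
  by move=> za wa; rewrite abszM -mulnn leq_mul.
have Cdiag := coveredX (covered_box3 a0) (coveredX (covered_box3 a0) (covered_box3 a0)).
have Cnz : covered (fun A => P A /\ nz A)
   (3 * a * (3 * a * (3 * a)) * (3 * ((b.*2 %/ q).+1 * ((b.*2 %/ q).+1 * (b.*2 %/ q).+1) *
     (2 * maxdiv N * (2 * maxdiv N * (2 * maxdiv N)))))).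
  apply: (covered_fiber (f := fun A : 'M[int]_3 => (A 0 0, (A 1 1, A 2 2))) Cdiag).
    by move=> A [[[_ sA] _ _] _] /=; rewrite !sA.
  move=> [d0 [d1 d2]] /= [d0a [d1a d2a]].
  have [s s3 Hs] := shifted_root_count (d0%:~R + d1%:~R + d2%:~R : 'F_q).
  pose Q (l : 'F_q) (A : 'M[int]_3) := [/\ P A, nz A, A 0 0 = d0 /\ A 1 1 = d1 /\ A 2 2 = d2 &
     exists x y, rank_one_shift A l x y].
  have HQ l : l \in s -> covered (Q l) ((b.*2 %/ q).+1 * ((b.*2 %/ q).+1 * (b.*2 %/ q).+1) *
     (2 * maxdiv N * (2 * maxdiv N * (2 * maxdiv N)))).
    move=> _.
    have Cm := coveredX (covered_residue b (l * (d0%:~R + d1%:~R) - l ^+ 2) pq)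
        (coveredX (covered_residue b (l * (d0%:~R + d2%:~R) - l ^+ 2) pq)
                  (covered_residue b (l * (d1%:~R + d2%:~R) - l ^+ 2) pq)).
    apply: (covered_fiber (f := fun A : 'M[int]_3 => (A 0 0 * A 1 1 - A 0 1 * A 1 0,
       (A 0 0 * A 2 2 - A 0 2 * A 2 0, A 1 1 * A 2 2 - A 1 2 * A 2 1))) Cm).
      move=> A [[[dA sA] sB _] _ [e0 [e1 e2]] [x [y H]]] /=.
      rewrite !(rank_one_minor H) // e0 e1 e2.
      have := invmx3_diag u012 dA; have := invmx3_diag u021 dA; have := invmx3_diag u120 dA.
      by rewrite e0 e1 e2 => <- <- <-.
    move=> [m01 [m02 m12]] _.
    pose W := fun A : 'M[int]_3 => Q l A /\ [/\ A 0 1 * A 1 0 = d0 * d1 - m01,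
       A 0 2 * A 2 0 = d0 * d2 - m02 & A 1 2 * A 2 1 = d1 * d2 - m12].
    suff C : covered W (2 * maxdiv N * (2 * maxdiv N * (2 * maxdiv N))).
      apply: (covered_sub C) => // A; rewrite /W => -[QA [<- <- <-]]; split=> //.
      by have [_ _ [-> [-> ->]] _] := QA; split; ring.
    (* A matrix [B] in the fibre, if there is one, certifies that the three prescribed products are
       nonzero and at most [a ^ 2]. *)
    have [[B [QB [B1 B2 B3]]]|nW] := pselect (exists B, W B); last first.
      by apply: covered0 => A WA; apply: nW; exists A.
    have [[[dB sB] _ _] nB _ _] := QB.
    have cf (z w p : int) : z * w = p -> z != 0 -> w != 0 -> (absz z <= a)%N -> (absz w <= a)%N ->
        covered (fun z : int => exists w, z * w = p) (2 * maxdiv N).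
      move=> <- z0 w0 za wa; apply: covered_factor; first by rewrite mulf_neq0.
      by have := aa _ _ za wa; lia.
    have Cf := coveredX (cf _ _ _ B1 (nB 0 1 isT) (nB 1 0 isT) (sB 0 1) (sB 1 0))
       (coveredX (cf _ _ _ B2 (nB 0 2 isT) (nB 2 0 isT) (sB 0 2) (sB 2 0))
                 (cf _ _ _ B3 (nB 1 2 isT) (nB 2 1 isT) (sB 1 2) (sB 2 1))).
    apply: (covered_inj (f := fun A : 'M[int]_3 => (A 0 1, (A 0 2, A 1 2))) Cf).
      by move=> A [_ [E1 E2 E3]] /=; split; [exists (A 1 0)|split; [exists (A 2 0)|exists (A 2 1)]].
    move=> A A' [[_ nA [a00 [a11 a22]] _] [E1 E2 E3]] [[_ nA' [a00' [a11' a22']] _] [E1' E2' E3']] [e1 e2 e3].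
    have f1 : A 1 0 = A' 1 0 by apply: (mulfI (nA 0 1 isT)); rewrite E1 e1 E1'.
    have f2 : A 2 0 = A' 2 0 by apply: (mulfI (nA 0 2 isT)); rewrite E2 e2 E2'.
    have f3 : A 2 1 = A' 2 1 by apply: (mulfI (nA 1 2 isT)); rewrite E3 e3 E3'.
    apply/matrixP; apply: ord3_ind012; apply: ord3_ind012 => //.
    - by rewrite a00 a00'.
    - by rewrite a11 a11'.
    - by rewrite a22 a22'.
  apply: (covered_sub (covered_bigU s3 HQ)) => // A [[PA nA] [e0 e1 e2]].
  have [[dA _] _ [l [x [y H]]]] := PA.
  exists l; last by split=> //; exists x, y.
  by apply: Hs; rewrite -e0 -e1 -e2 -(rank_one_det H u012) dA.
have Cd (i : 'I_3) := covered_degenerate pq a0 aq i.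
have Cdt (i : 'I_3) : covered (fun A : 'M[int]_3 => small_unimodular a A^T /\
    exists (l : 'F_q) x y, rank_one_shift A^T l x y /\ x i = 0) (243 * a ^ 3).
  apply: (covered_inj (f := fun A : 'M[int]_3 => A^T) (Cd i)) => // A A' _ _; exact: trmx_inj.
have C1 := covered_bigU (s := enum 'I_3) (n := 3) _ (fun i _ => Cd i).
have C2 := covered_bigU (s := enum 'I_3) (n := 3) _ (fun i _ => Cdt i).
have s3 : (size (enum 'I_3) <= 3)%N by rewrite size_enum_ord.
apply: (covered_sub (coveredU Cnz (coveredU (C1 s3) (C2 s3)))).
  move=> A PA; have [[dA sA] _ [l [x [y H]]]] := PA.
  have [/existsP[i /existsP[j /andP[ij /eqP Aij]]]|nex] :=
      boolP [exists i, exists j, (i != j) && (A i j == 0)]; last first.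
    left; split=> // i j ij; apply: contra nex => Aij.
    by apply/existsP; exists i; apply/existsP; exists j; rewrite ij.
  right; have /esym/eqP := H i j; rewrite Aij (negbTE ij) add0r mulf_eq0 => /orP[] /eqP e.
    by left; exists i; rewrite ?mem_enum //; split=> //; exists l, x, y.
  right; exists j; rewrite ?mem_enum //; split; first by split=> [|m n]; rewrite ?det_tr ?mxE.
  by exists l, y, x; split=> //; apply: rank_one_shift_tr.
move: (b.*2 %/ q)%N D0 => r; move: (maxdiv N) => D D0.
(* Here [648 = 27 * 3 * 8] counts diagonals, values of [l] and signed divisors, and [1458 = 6 * 243]
   the degenerate matrices and their transposes. *)
apply: (@leq_trans (648 * (a ^ 3 * r.+1 ^ 3 * D ^ 3) + 1458 * a ^ 3)).
  by apply/eq_leq; ring.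
rewrite -[2106%N]/(648 + 1458)%N mulnDl leq_add2l leq_mul2l /= -mulnA.
by rewrite leq_pmulr // muln_gt0 !expn_gt0 D0.
Qed.


(** * Unimodular matrices sorted by their reduction modulo [q] *)

Definition modq (q : nat) (A : 'M[int]_3) : 'M['F_q]_3 := map_mx intr A.

Definition rank_one_mod (q : nat) (A : 'M[int]_3) : Prop :=
  exists (l : 'F_q) (x : 'cV_3) (y : 'rV_3), modq q A = l%:M + x *m y.

Definition scalar_mod (q : nat) (A : 'M[int]_3) : Prop :=
  exists l : 'F_q, modq q A = l%:M.

Definition bounded_SL3 (t : nat) (A : 'M[int]_3) : Prop :=
  \det A = 1 /\ (mnorm A * mnorm (invmx A) <= t)%N.

Lemma det1_unit (A : 'M[int]_3) : \det A = 1 -> A \in unitmx.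
Proof. by move=> dA; rewrite unitmxE dA unitr1. Qed.

Lemma modq_inv (q : nat) (A : 'M[int]_3) : \det A = 1 ->
  modq q A *m modq q (invmx A) = 1%:M.
Proof. by move=> dA; rewrite -map_mxM mulmxV ?det1_unit // map_mx1. Qed.

Lemma scalar_mod_inv (q : nat) (A : 'M[int]_3) : \det A = 1 ->
  scalar_mod q A -> scalar_mod q (invmx A).
Proof.
move=> dA [l lE]; have := modq_inv q dA; rewrite lE mul_scalar_mx => e.
have l0 : l != 0.
  apply/eqP => l0; move: e; rewrite l0 scale0r => /matrixP/(_ 0 0).
  by rewrite !mxE => /esym/eqP; rewrite oner_eq0.
exists l^-1; apply: (scalerI l0).
by rewrite e scale_scalar_mx mulfV.
Qed.

(** Here [l] is nonzero, since otherwise an invertible matrix would have rank at most 1. Multiplying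
    [A = l + x y] by the inverse gives [1 = l A^-1 + (A^-1 x) y], which is solved for [A^-1]. *)
Lemma rank_one_mod_inv (q : nat) (A : 'M[int]_3) : \det A = 1 ->
  rank_one_mod q A -> rank_one_mod q (invmx A).
Proof.
move=> dA [l [x [y lE]]]; have e := modq_inv q dA; have e' := mulmx1C e.
have l0 : l != 0.
  apply/eqP => l0; move: e; rewrite lE l0 -[0%:M]scalemx1 scale0r add0r -mulmxA => e.
  have := mulmx_max_rank x (y *m modq q (invmx A)).
  by rewrite e mxrank1.
exists l^-1, (- (l^-1 *: (modq q (invmx A) *m x))), y; apply: (scalerI l0).
rewrite scalerDr scale_scalar_mx mulfV // mulNmx scalerN -scalemxAl scalerA mulfV // scale1r.
rewrite -[X in _ = X - _]e' lE mulmxDr -mulmxA addrK mul_mx_scalar //.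
Qed.

Lemma rank_one_mod_shift (q : nat) (A : 'M[int]_3) : rank_one_mod q A ->
  exists (l : 'F_q) x y, rank_one_shift A l x y.
Proof.
move=> [l [x [y e]]]; exists l, (fun i => x i 0), (fun j => y 0 j) => i j.
by move/matrixP/(_ i j): e; rewrite !mxE big_ord1.
Qed.

(** Inversion exchanges the two norms, so a count for an inversion-stable property may assume that
    [A] is the smaller of the two matrices. *)
Lemma covered_half (t n : nat) (P : 'M[int]_3 -> Prop) :
  (forall A, \det A = 1 -> P A -> P (invmx A)) ->
  covered (fun A => [/\ bounded_SL3 t A, P A & (mnorm A <= mnorm (invmx A))%N]) n ->
  covered (fun A => bounded_SL3 t A /\ P A) (n + n).
Proof.
move=> Pinv C.
have C' : covered (fun A => [/\ bounded_SL3 t A, P A & (mnorm (invmx A) <= mnorm A)%N]) n.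
  apply: (covered_inj (f := fun A : 'M[int]_3 => invmx A) C) => [A|A B _ _ e].
    move=> [[dA At] PA le]; split; rewrite ?invmxK //; last exact: Pinv.
    by split; rewrite ?invmxK 1?mulnC // det_inv dA invr1.
  by rewrite -[A]invmxK -[B]invmxK e.
apply: (covered_sub (coveredU C C')) => // A [At PA].
by case: (leqP (mnorm A) (mnorm (invmx A))) => [le|/ltnW le]; [left|right].
Qed.

Lemma leq_entry_mnorm (A : 'M[int]_3) i j : (absz (A i j) <= mnorm A)%N.
Proof. exact: leq_trans (leq_fnorm (A i) j) (leq_mnorm A i). Qed.

Lemma mnorm_gt0 (A : 'M[int]_3) : A \in unitmx -> (0 < mnorm A)%N.
Proof.
move=> uA; rewrite lt0n; apply/eqP => A0.
suff A00 : A = 0.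
  by move: uA; rewrite A00 unitmxE det0.
apply/matrixP => i j; rewrite mxE; apply/eqP.
by rewrite -absz_eq0 -leqn0; apply: leq_trans (leq_entry_mnorm A i j) _; rewrite A0.
Qed.

Lemma covered_scalar_mod (q t : nat) : prime q -> (256 * t <= q ^ 2)%N ->
  covered (fun A => bounded_SL3 t A /\ scalar_mod q A) 54.
Proof.
move=> pq tq; apply: (@covered_half _ 27); first exact: scalar_mod_inv.
have C := coveredX (covered_box 1) (coveredX (covered_box 1) (covered_box 1)).
have off A : [/\ bounded_SL3 t A, scalar_mod q A & (mnorm A <= mnorm (invmx A))%N] ->
    forall i j, i != j -> A i j = 0.
  move=> [[dA At] [l lE] le] i j ij; apply: (intr_Fp_eq0 pq).
    by move/matrixP/(_ i j): lE; rewrite !mxE (negbTE ij).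
  apply: leq_ltn_trans (leq_entry_mnorm A i j) _.
  have q0 := prime_gt0 pq.
  have h : (mnorm A * mnorm A <= t)%N by apply: leq_trans At; rewrite leq_mul2l le orbT.
  rewrite -(ltn_exp2r _ _ (isT : (0 < 2)%N)) -mulnn; nia.
apply: (covered_inj (f := fun A : 'M[int]_3 => (A 0 0, (A 1 1, A 2 2))) C) => /=.
  move=> A PA; have z := off A PA; have [[dA _] _ _] := PA.
  move: dA; rewrite (det3E _ (isT : uniq [:: 0; 1; 2 : 'I_3])).
  rewrite (z 0 1) // (z 0 2) // (z 1 2) // !mul0r !subr0 ?addr0.
  move=> /(congr1 absz)/eqP; rewrite !abszM !muln_eq1.
  by move=> /and3P[/eqP-> /eqP-> /eqP->].
move=> A B PA PB [e0 e1 e2].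
by apply/matrixP; apply: ord3_ind012; apply: ord3_ind012; rewrite ?e0 ?e1 ?e2 //;
  rewrite (off A PA) // (off B PB).
Qed.

(** With [r = 2 b / q], split [(r + 1) ^ 3 <= 4 r ^ 3 + 4]. The constant part uses [a <= q / 4] and
    [a ^ 2 <= 4 t]. The cubic part uses [a r q <= 4 t], whence
    [4 (a r q) ^ 3 <= 256 t ^ 3 <= q ^ 4 t]. *)
Lemma dyadic_arith (q t a b : nat) : (0 < q)%N -> (256 * t <= q ^ 2)%N ->
  (a ^ 2 <= 4 * t)%N -> (a * b <= 2 * t)%N ->
  (a ^ 3 * (b.*2 %/ q).+1 ^ 3 <= 5 * (q * t))%N.
Proof.
move=> q0 tq at2 abt; set r := (_ %/ _)%N.
have rq : (r * q <= 2 * b)%N by rewrite mul2n leq_divM.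
have aq : (4 * a <= q)%N.
  by rewrite -(leq_exp2r _ _ (isT : (0 < 2)%N)) expnMn; nia.
have xq : (a * r * q <= 4 * t)%N by nia.
have r3 : (r.+1 ^ 3 <= 4 * r ^ 3 + 4)%N.
  rewrite -addn1; have : (3 * r ^ 2 <= 3 * r ^ 3 + 1)%N by case: r {rq xq} => // r; nia.
  nia.
have h1 : (a ^ 3 * 4 <= 4 * (q * t))%N by nia.
have h2 : (4 * (a * r) ^ 3 <= q * t)%N.
  rewrite -(@leq_pmul2l (q ^ 3)) ?expn_gt0 ?q0 //.
  have : ((a * r * q) ^ 3 <= (4 * t) ^ 3)%N by rewrite leq_exp2r.
  rewrite !expnMn => h.
  have t2 : (256 * t ^ 2 <= q ^ 4)%N.
    by rewrite (_ : q ^ 4 = q ^ 2 * q ^ 2)%N; [nia|rewrite -expnD].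
  have : (256 * t ^ 2 * t <= q ^ 4 * t)%N by rewrite leq_mul2r t2 orbT.
  nia.
apply: (@leq_trans (a ^ 3 * (4 * r ^ 3 + 4))); first by rewrite leq_mul2l r3 orbT.
rewrite mulnDr; move: h1 h2; rewrite expnMn; nia.
Qed.

Lemma covered_rank_one_mod : exists K, forall q t L N : nat, prime q ->
  (256 * t <= q ^ 2)%N -> (t < 2 ^ L)%N -> (8 * t <= N)%N ->
  covered (fun A => bounded_SL3 t A /\ rank_one_mod q A)
    (K * (L * (q * t) * maxdiv N ^ 3)).
Proof.
exists (2 * (2106 * 5))%N => q t L N pq tq tL tN; have q0 := prime_gt0 pq.
pose n := (L * (2106 * (5 * (q * t) * maxdiv N ^ 3)))%N.
have nn : (n + n = 2 * (2106 * 5) * (L * (q * t) * maxdiv N ^ 3))%N.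
  rewrite /n; move: (maxdiv N ^ 3)%N => D; ring.
rewrite -nn; apply: covered_half; first exact: rank_one_mod_inv.
(* The dyadic piece [2 ^ i <= |A| < 2 ^ (i + 1)]. Its first clause records that [A] is not larger
   than its inverse, and yields [a ^ 2 <= 4 t] for [a = 2 ^ (i + 1)]. *)
pose P (i : nat) (A : 'M[int]_3) := [/\ (2 ^ i * 2 ^ i <= t)%N, small_unimodular (2 ^ i.+1) A,
  forall k, (absz (invmx A k k) <= t %/ 2 ^ i)%N &
  exists (l : 'F_q) x y, rank_one_shift A l x y].
have H i : covered (P i) (2106 * (5 * (q * t) * maxdiv N ^ 3)).
  have [it|it] := leqP (2 ^ i * 2 ^ i) t; last first.
    by apply: covered0 => A [+ _ _ _]; rewrite leqNgt it.
  have a0 : (0 < 2 ^ i.+1)%N by rewrite expn_gt0.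
  have a2 : ((2 ^ i.+1) ^ 2 <= 4 * t)%N.
    by rewrite [(2 ^ i.+1)%N]expnS expnMn -[((2 ^ i) ^ 2)%N]mulnn leq_mul2l it.
  have aq : (4 * 2 ^ i.+1 < q)%N.
    by rewrite -(ltn_exp2r _ _ (isT : (0 < 2)%N)) expnMn; nia.
  have aN : (2 * (2 ^ i.+1) ^ 2 <= N)%N by lia.
  have ab : (2 ^ i.+1 * (t %/ 2 ^ i) <= 2 * t)%N.
    by rewrite expnS -mulnA leq_mul2l /= mulnC leq_divM.
  apply: (covered_sub (covered_rank_one (t %/ 2 ^ i) pq a0 aq aN)).
    by move=> A [_ sA sB r1].
  by rewrite leq_mul2l leq_mul2r dyadic_arith ?orbT.
apply: (covered_sub (covered_bigU (s := iota 0 L) (n := L) _ (fun i _ => H i))) => //.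
  by rewrite size_iota.
move=> A [[dA At] rA le]; have a0 := mnorm_gt0 (det1_unit dA).
have b0 : (0 < mnorm (invmx A))%N by apply: leq_trans le.
have /andP[la ua] := @trunc_log_bounds 2 (mnorm A) isT a0.
set i := trunc_log 2 (mnorm A) in la ua.
have lt : (2 ^ i * mnorm (invmx A) <= t)%N by apply: leq_trans At; rewrite leq_mul2r la orbT.
exists i.
  rewrite mem_iota /= add0n -(ltn_exp2l _ _ (isT : (1 < 2)%N)).
  by apply: leq_ltn_trans tL; apply: leq_trans lt; rewrite leq_pmulr.
split.
- by apply: leq_trans lt; rewrite leq_mul2l (leq_trans la le) orbT.
- by split=> // k m; apply: leq_trans (leq_entry_mnorm _ _ _) (ltnW ua).
- by move=> k; rewrite leq_divRL ?expn_gt0 // mulnC; apply: leq_trans lt; rewrite leq_mul2l leq_entry_mnorm orbT.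
- exact: rank_one_mod_shift.
Qed.


(** * Fixed points on the projective plane *)

Section ProjectivePoints.
Variable F : finFieldType.
Implicit Types (x y : P2 F) (M : 'M[F]_3).

(** The default 0 is never reached, as every class is nonempty. *)
Definition P2_repr x : 'cV[F]_3 := odflt 0 [pick v in P2_class x].

Lemma P2_reprP x :
  P2_repr x != 0 /\ P2_class x = [set w in nzvec F | proportional (P2_repr x) w].
Proof.
have /imsetP[v v0 xE] := valP x; rewrite /= in xE.
have vv : v \in P2_class x.
  by rewrite xE inE v0; apply/proportionalP; exists 1; rewrite ?oner_neq0 ?scale1r.
have rx : P2_repr x \in P2_class x.
  by rewrite /P2_repr; case: pickP => [//|/(_ v)]; rewrite vv.
move: rx; rewrite xE inE => /andP[r0 /proportionalP[a a0 ra]].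
split; first by move: r0; rewrite inE.
apply/setP => w; rewrite !inE; congr (_ && _); rewrite ra.
apply/proportionalP/proportionalP => -[b b0 ->].
  by exists (b / a); rewrite ?mulf_neq0 ?invr_eq0 // scalerA divfK.
by exists (b * a); rewrite ?mulf_neq0 // scalerA.
Qed.

Lemma P2_repr_inj (c : F) x y : P2_repr y = c *: P2_repr x -> x = y.
Proof.
move=> e; have [x0 xE] := P2_reprP x; have [y0 yE] := P2_reprP y.
have c0 : c != 0 by apply: contraNneq y0 => c0; rewrite e c0 scale0r.
apply: val_inj; rewrite /= xE yE e; apply/setP => w; rewrite !inE; congr (_ && _).
apply/proportionalP/proportionalP => -[b b0 ->].
  by exists (b / c); rewrite ?mulf_neq0 ?invr_eq0 // scalerA divfK.
by exists (b * c); rewrite ?mulf_neq0 // scalerA.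
Qed.

Lemma covered_finType (T : finType) : covered (fun _ : T => True) #|T|.
Proof. by exists (enum T); rewrite ?cardE // => x _; rewrite mem_enum. Qed.

Lemma cV3_inj (u v : 'cV[F]_3) (i j k : 'I_3) : uniq [:: i; j; k] ->
  u i 0 = v i 0 -> u j 0 = v j 0 -> u k 0 = v k 0 -> u = v.
Proof.
move=> ijk ui uj uk; apply/colP => z; move: z.
exact: (ord3_ind (P := fun z => u z 0 = v z 0) ijk).
Qed.

(** Three affine charts: where coordinate [i] is nonzero, the two ratios to it determine the
    point. *)
Lemma covered_P2 : covered (fun _ : P2 F => True) (3 * #|F| ^ 2).
Proof.
pose P (i : 'I_3) x := P2_repr x i 0 != 0.
have H i : covered (P i) (#|F| ^ 2).
  have [j ij] : exists j, i != j by exists (i + 1); move: i => [[|[|[|//]]] ?].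
  have [k ijk] := ord3_third ij.
  rewrite -mulnn; apply: (covered_inj (f := fun x => (P2_repr x j 0 / P2_repr x i 0,
    P2_repr x k 0 / P2_repr x i 0)) (coveredX (covered_finType F) (covered_finType F))) => //.
  move=> x y; rewrite /P => xi yi [ej ek].
  apply: (@P2_repr_inj (P2_repr y i 0 / P2_repr x i 0)).
  apply: (cV3_inj ijk); rewrite !mxE ?divfK //.
    by rewrite mulrAC -mulrA ej mulrC divfK.
  by rewrite mulrAC -mulrA ek mulrC divfK.
have s3 : (size (enum 'I_3) <= 3)%N by rewrite size_enum_ord.
apply: (covered_sub (covered_bigU s3 (fun i _ => H i))) => // x _.
have [/cV0Pn[i xi] _] := P2_reprP x.
by exists i; rewrite ?mem_enum.
Qed.

(** A row with nonzero entry at [i] confines the points to a line. Each has a nonzero coordinate [j]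
    or [k], and in that chart the ratio of these two determines the point. *)
Lemma covered_P2_kernel M : M != 0 ->
  covered (fun x => M *m P2_repr x = 0) (2 * #|F|).
Proof.
case/matrix0Pn => m [i Mmi].
pose P (j : 'I_3) x := M *m P2_repr x = 0 /\ P2_repr x j 0 != 0.
have H j : j != i -> covered (P j) #|F|.
  move=> ji; have [k jik] := ord3_third ji.
  apply: (covered_inj (f := fun x => P2_repr x k 0 / P2_repr x j 0) (covered_finType F)) => //.
  move=> x y [Mx xj] [My yj] ek.
  apply: (@P2_repr_inj (P2_repr y j 0 / P2_repr x j 0)).
  have yk : P2_repr y k 0 = P2_repr y j 0 / P2_repr x j 0 * P2_repr x k 0.
    by rewrite mulrAC -mulrA ek mulrC divfK.
  apply: (cV3_inj jik); rewrite !mxE ?divfK //.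
  have := congr1 (fun Z : 'cV[F]_3 => Z m 0) My; have := congr1 (fun Z : 'cV[F]_3 => Z m 0) Mx.
  rewrite !mxE !(ord3_sum _ jik) yk.
  set c := P2_repr y j 0 / P2_repr x j 0.
  have -> : P2_repr y j 0 = c * P2_repr x j 0 by rewrite divfK.
  move=> h1 h2; apply: (mulfI Mmi); apply/eqP; rewrite -subr_eq0; apply/eqP.
  transitivity ((M m j * (c * P2_repr x j 0) + M m i * P2_repr y i 0 + M m k * (c * P2_repr x k 0))
    - c * (M m j * P2_repr x j 0 + M m i * P2_repr x i 0 + M m k * P2_repr x k 0)); first by ring.
  by rewrite h1 h2 mulr0 subr0.
have [j ji] : exists j, j != i by exists (i + 1); move: i {Mmi H} => [[|[|[|//]]] ?].
have [k jik] := ord3_third ji.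
have ki : k != i by move: jik; rewrite /= !inE [k == i]eq_sym => /and3P[_ ->].
rewrite mul2n -addnn; apply: (covered_sub (coveredU (H j ji) (H k ki))) => // x Mx.
have [xj|xj] := eqVneq (P2_repr x j 0) 0; last by left.
have [xk|xk] := eqVneq (P2_repr x k 0) 0; last by right.
have [x0 _] := P2_reprP x; case/eqP: x0.
apply: (cV3_inj jik); rewrite !mxE //; apply: (mulfI Mmi); rewrite mulr0.
have := congr1 (fun Z : 'cV[F]_3 => Z m 0) Mx.
by rewrite !mxE (ord3_sum _ jik) xj xk !mulr0 add0r addr0.
Qed.

(** Two distinct points in the kernel would span a plane in it, and then all columns of [M] would be
    multiples of a single one. *)
Lemma covered_P2_line M : (forall (u : 'cV_3) (v : 'rV_3), M != u *m v) ->
  covered (fun x => M *m P2_repr x = 0) 1.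
Proof.
move=> nM; apply: covered1 => x y Mx My.
have [/cV0Pn[i vi] _] := P2_reprP x.
set v := P2_repr x in Mx vi; set w := P2_repr y in My.
pose c := w i 0 / v i 0; pose z := w - c *: v.
have [z0|/cV0Pn[j zj]] := eqVneq z 0.
  by apply: (@P2_repr_inj c); apply/eqP; rewrite -subr_eq0; apply/eqP.
have Mz : M *m z = 0 by rewrite mulmxBr -scalemxAr Mx My scaler0 subrr.
have zi : z i 0 = 0 by rewrite !mxE divfK // subrr.
clearbody z.
have ij : i != j by apply: contraNneq zj => <-; rewrite zi.
have [k ijk] := ord3_third ij.
(* As [z i 0 = 0], the equation [M z = 0] makes column [j] equal to [tj] times column [k]; then
   [M v = 0] makes column [i] equal to [ti] times column [k]. *)
pose tj := - (z k 0 / z j 0); pose ti := - ((tj * v j 0 + v k 0) / v i 0).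
pose u := \row_m (if m == i then ti else if m == j then tj else 1).
have [ik jk] : i != k /\ j != k.
  by move: ijk; rewrite /= !inE negb_or => /and3P[/andP[_ ->] ->].
have := nM (col k M) u; case/eqP; apply/matrixP => m n.
have row0 (w' : 'cV[F]_3) : M *m w' = 0 -> M m i * w' i 0 + M m j * w' j 0 + M m k * w' k 0 = 0.
  by move=> /colP/(_ m); rewrite !mxE (ord3_sum _ ijk).
have h1 := row0 _ Mx; have := row0 _ Mz; rewrite zi mulr0 add0r => h2.
have Mj : M m j = M m k * tj.
  apply: (mulIf zj); rewrite /tj mulrN mulNr -!mulrA mulVf // mulr1.
  by apply/eqP; rewrite -addr_eq0 h2.
have Mi : M m i = M m k * ti.
  apply: (mulIf vi); rewrite /ti mulrN mulNr -!mulrA mulVf // mulr1.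
  apply/eqP; rewrite -addr_eq0 -h1 Mj; apply/eqP; ring.
rewrite mxE big_ord1 !mxE; move: n; apply: (ord3_ind ijk).
- by rewrite eqxx.
- by rewrite eq_sym (negbTE ij) eqxx.
- by rewrite [k == i]eq_sym (negbTE ik) [k == j]eq_sym (negbTE jk) mulr1.
Qed.

Lemma eigenvalue_list M : exists2 s : seq F, (size s <= 3)%N &
  forall l (v : 'cV[F]_3), v != 0 -> M *m v = l *: v -> l \in s.
Proof.
(* The transpose is there because [eigenvalue] refers to row vectors. *)
exists [seq l <- enum F | root (char_poly M^T) l].
  rewrite -ltnS -[4%N](size_char_poly M^T); apply: max_poly_roots; last exact/filter_uniq/enum_uniq.
  - by rewrite monic_neq0 // char_poly_monic.
  - by rewrite all_filter; apply/allP => l _; apply/implyP.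
move=> l v v0 Mv; rewrite mem_filter mem_enum andbT -eigenvalue_root_char.
apply/eigenvalueP; exists v^T; last by rewrite trmx_eq0.
by rewrite -trmx_mul Mv linearZ.
Qed.

Lemma covered_eigenpoints M n :
  (forall l, covered (fun x => (M - l%:M) *m P2_repr x = 0) n) ->
  covered (fun x => exists l, M *m P2_repr x = l *: P2_repr x) (3 * n).
Proof.
move=> H; have [s s3 Hs] := eigenvalue_list M.
apply: (covered_sub (covered_bigU s3 (fun l _ => H l))) => // x [l Mx].
have [x0 _] := P2_reprP x; exists l; first exact: Hs Mx.
by rewrite mulmxBl mul_scalar_mx Mx subrr.
Qed.

End ProjectivePoints.

Lemma Phi_fixed_eigen (q : nat) (g : SL3Z) (x : P2 'F_q) : Phi q g x = x ->
  exists l, modq q g *m P2_repr x = l *: P2_repr x.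
Proof.
rewrite permE => e; have [x0 xE] := P2_reprP x.
have : redmx q g *m P2_repr x \in P2_class (P2_act g x).
  rewrite imset_f // xE !inE x0; apply/proportionalP.
  by exists 1; rewrite ?oner_neq0 ?scale1r.
by rewrite e xE inE => /andP[_ /proportionalP[l _ le]]; exists l.
Qed.

Section FixedPoints.
Variables (q : nat) (g : SL3Z).
Hypothesis pq : prime q.

Lemma covered_fixed_all : covered (fun x => Phi q g x = x) (3 * q ^ 2).
Proof.
by have := covered_P2 'F_q; rewrite card_Fp // => C; apply: (covered_sub C).
Qed.

Lemma covered_fixed_nonscalar : ~ scalar_mod q g ->
  covered (fun x => Phi q g x = x) (6 * q).
Proof.
move=> ns; rewrite -[6%N]/(3 * 2)%N -mulnA.
apply: (@covered_sub _ _ (fun x => exists l, modq q g *m P2_repr x = l *: P2_repr x) (3 * (2 * q))) => //.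
  apply: covered_eigenpoints => l; have := card_Fp pq.
  move: #|_| (@covered_P2_kernel 'F_q (modq q g - l%:M)) => n + nq; rewrite nq; apply.
  by apply/eqP => /subr0_eq gl; apply: ns; exists l.
exact: Phi_fixed_eigen.
Qed.

Lemma covered_fixed_generic : ~ rank_one_mod q g ->
  covered (fun x => Phi q g x = x) 3.
Proof.
move=> nr.
apply: (@covered_sub _ _ (fun x => exists l, modq q g *m P2_repr x = l *: P2_repr x) (3 * 1)) => //.
  apply: covered_eigenpoints => l; apply: covered_P2_line => u v.
  apply/eqP => e; apply: nr; exists l, u, v.
  by rewrite -e addrC subrK.
exact: Phi_fixed_eigen.
Qed.

End FixedPoints.

(** * Counting the fixed pairs *)

Definition fixed_pairs_nat (q t : nat) (gx : SL3Z * P2 'F_q) : Prop :=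
  (mnorm gx.1 * mnorm (invmx gx.1) <= t)%N /\ Phi q gx.1 gx.2 = gx.2.

Lemma SL3Z_det (g : SL3Z) : \det g = 1.
Proof. exact/eqP/(valP g). Qed.

Lemma covered_SL3Z (P : 'M[int]_3 -> Prop) n : covered P n ->
  covered (fun g : SL3Z => P g) n.
Proof. by move=> C; apply: (covered_inj (f := val) C) => // g h _ _ /val_inj. Qed.

Lemma covered_fixed_pairs_log : exists K, forall q t L N : nat, prime q ->
  (256 * t <= q ^ 2)%N -> (9 * t < 2 ^ L)%N -> (36 * t <= N)%N ->
  covered (@fixed_pairs_nat q t) (K * (L * q ^ 2 * t * maxdiv N ^ 3)).
Proof.
have [K HK] := covered_bounded_pair.
have [K1 HK1] := covered_rank_one_mod.
(* A generic matrix has at most 3 fixed points, a nonscalar one [6 * q], and the 54 scalar ones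
   [3 * q ^ 2] each, with [54 * 3 = 162]. *)
exists (3 * K + 6 * K1 + 162)%N => q t L N pq tq tL tN; have q0 := prime_gt0 pq.
(* For [t = 0] there are no pairs, as both norms are positive. For [t > 0] the constant number of
   scalar matrices is absorbed into [t]. *)
have [t0|t0] := posnP t.
  apply: covered0 => -[g x] [/=]; rewrite t0 leqn0 muln_eq0.
  have u := det1_unit (SL3Z_det g).
  by rewrite !eqn0Ngt !mnorm_gt0 // unitmx_inv.
have L0 : (0 < L)%N by case: L tL => // h; move: h; rewrite expn0; lia.
have D0 : (0 < maxdiv N)%N by apply: maxdiv_gt0; lia.
pose Pgen (gx : SL3Z * P2 'F_q) := fixed_pairs_nat t gx /\ ~ rank_one_mod q gx.1.
pose Peig (gx : SL3Z * P2 'F_q) := [/\ fixed_pairs_nat t gx, rank_one_mod q gx.1 & ~ scalar_mod q gx.1].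
pose Psc (gx : SL3Z * P2 'F_q) := fixed_pairs_nat t gx /\ scalar_mod q gx.1.
have C1 : covered Pgen (K * (L * t ^ 2 * maxdiv N) * 3).
  have [nr|nr] := pselect (exists g : SL3Z, ~ rank_one_mod q g); last first.
    by apply: covered0 => gx [_ h]; apply: nr; exists gx.1.
  apply: (covered_fiber (f := fst) (covered_SL3Z (HK t L N tL tN))).
    move=> [g x] [[/= gt _] _]; split=> //; exact/det1_unit/SL3Z_det.
  move=> g _; have [rg|ng] := pselect (rank_one_mod q g).
    by apply: covered0 => -[h x] [[_ /= nh] /= hg]; apply: nh; rewrite hg.
  apply: (covered_inj (f := snd) (covered_fixed_generic ng)).
    by move=> [h x] [[[_ /= fx] _] /= <-].
  by move=> [h x] [h' x'] [_ /= ->] [_ /= ->] ->.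
have C2 : covered Peig (K1 * (L * (q * t) * maxdiv N ^ 3) * (6 * q)).
  have t8 : (8 * t <= N)%N by lia.
  have tL' : (t < 2 ^ L)%N by lia.
  apply: (covered_fiber (f := fst) (covered_SL3Z (HK1 q t L N pq tq tL' t8))).
    by move=> [g x] [[/= gt _] r _]; split=> //; split=> //; apply: SL3Z_det.
  move=> g _; have [sg|ng] := pselect (scalar_mod q g).
    by apply: covered0 => -[h x] [[_ _ /= nh] /= hg]; apply: nh; rewrite hg.
  apply: (covered_inj (f := snd) (covered_fixed_nonscalar pq ng)).
    by move=> [h x] [[[_ /= fx] _ _] /= <-].
  by move=> [h x] [h' x'] [_ /= ->] [_ /= ->] ->.
have C3 : covered Psc (54 * (3 * q ^ 2)).
  apply: (covered_fiber (f := fst) (covered_SL3Z (covered_scalar_mod pq tq))).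
    by move=> [g x] [[/= gt _] s]; split=> //; split=> //; apply: SL3Z_det.
  move=> g _; apply: (covered_inj (f := snd) (covered_fixed_all g pq)).
    by move=> [h x] [[[_ /= fx] _] /= <-].
  by move=> [h x] [h' x'] [_ /= ->] [_ /= ->] ->.
apply: (covered_sub (coveredU C1 (coveredU C2 C3))).
  move=> gx Pgx; have [r|r] := pselect (rank_one_mod q gx.1); last by left.
  by right; have [s|s] := pselect (scalar_mod q gx.1); [right|left].
have D3 : (maxdiv N <= maxdiv N ^ 3)%N by rewrite -{1}[maxdiv N]expn1 leq_pexp2l.
have D30 : (0 < maxdiv N ^ 3)%N by rewrite expn_gt0 D0.
rewrite addnA (mulnDl (3 * K + 6 * K1)%N) (mulnDl (3 * K)%N); apply: leq_add; first apply: leq_add.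
- apply: (@leq_trans (3 * K * (L * (t * t) * maxdiv N))).
    by apply/eq_leq; move: (maxdiv N) => D; ring.
   rewrite leq_mul2l -[(L * q ^ 2 * t)%N]mulnA; apply/orP; right.
  by apply: leq_mul D3; apply: leq_mul => //; rewrite leq_mul2r; apply/orP; right; lia.
- by apply/eq_leq; move: (maxdiv N ^ 3)%N => E; ring.
- apply: (@leq_trans (162 * q ^ 2)); first by apply/eq_leq; ring.
  rewrite leq_mul2l /=; apply: (@leq_trans (q ^ 2 * (L * t * maxdiv N ^ 3))).
    by rewrite leq_pmulr // !muln_gt0 L0 t0 D0.
  by apply/eq_leq; move: (maxdiv N ^ 3)%N => E; ring.
Qed.


(** * The final bound *)

(* Absorbs the number of dyadic scales into [maxdiv]. *)
Lemma size_divisors_exp2 (m : nat) : (m < size (divisors (2 ^ m)))%N.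
Proof.
rewrite -{1}(size_iota 0 m.+1) -(size_map (expn 2)); apply: uniq_leq_size.
  by rewrite map_inj_uniq ?iota_uniq // => i j /eqP; rewrite eqn_exp2l // => /eqP.
move=> d /mapP[i]; rewrite mem_iota => /andP[_ im] ->.
by rewrite -dvdn_divisors ?expn_gt0 // dvdn_exp2l.
Qed.

Lemma covered_fixed_pairs_nat : exists K, forall q t : nat, prime q ->
  (256 * t <= q ^ 2)%N ->
  covered (@fixed_pairs_nat q t) (K * (q ^ 2 * t * maxdiv (q ^ 2) ^ 4)).
Proof.
have [K HK] := covered_fixed_pairs_log; exists K => q t pq tq.
have [t0|t0] := posnP t.
  have t1 : (9 * t < 2 ^ 1)%N by rewrite t0.
  have t2 : (36 * t <= q ^ 2)%N by rewrite t0.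
  by apply: (covered_sub (HK q t 1 (q ^ 2)%N pq tq t1 t2)) => //; rewrite t0 !(muln0, mul0n).
have t9 : (0 < 9 * t)%N by rewrite muln_gt0.
have /andP[lm um] := @trunc_log_bounds 2 (9 * t) isT t9.
set m := trunc_log _ _ in lm um.
apply: (covered_sub (HK q t m.+1 (q ^ 2)%N pq tq um _)) => //; first lia.
rewrite leq_mul2l; apply/orP; right.
(* One has [2 ^ m <= 9 * t <= q ^ 2], and [2 ^ m] already has more than [m] divisors. *)
have mD : (m.+1 <= maxdiv (q ^ 2))%N.
  by apply: leq_trans (size_divisors_exp2 m) _; apply: leq_maxdiv; lia.
apply: (@leq_trans (maxdiv (q ^ 2) * (q ^ 2) * t * maxdiv (q ^ 2) ^ 3)).
  by rewrite !leq_mul2r mD !orbT.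
apply/eq_leq; move: (maxdiv _) => D; ring.
Qed.

Lemma maxdiv_bound (k : nat) : (0 < k)%N ->
  exists2 C, (0 < C)%N & forall N, (0 < N)%N -> (maxdiv N ^ k <= C * N)%N.
Proof.
move=> k0; have [C C0 HC] := size_divisors_bound k0; exists C => // N N0.
have [|n Dn] := @bigop.eq_bigmax 'I_N.+1 (fun n => size (divisors n)).
  by rewrite card_ord.
(* The maximum may be attained at 0, where [divisors 0] has a single element. *)
rewrite /maxdiv Dn; have [n0|n0] := posnP n.
  by rewrite n0 exp1n muln_gt0 C0.
by apply: leq_trans (HC n n0) _; rewrite leq_mul2l -ltnS ltn_ord orbT.
Qed.

Lemma mnorm_le_mx_norm (A : 'M[int]_3) : (mnorm A)%:Z <= mx_norm A.
Proof.
have H i j : `|A i j| <= mx_norm A.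
  by rewrite mx_normrE; apply/bigmax_geP; right; exists (i, j).
have : (mnorm A <= absz (mx_norm A))%N.
  apply/bigmax_leqP => i _; apply/bigmax_leqP => j _.
  have := H i j; lia.
have := H 0 0; lia.
Qed.

Lemma maxdiv_powR (R : realType) (eps : R) : 0 < eps ->
  exists C : R, 0 <= C /\ forall q : nat, (0 < q)%N ->
    (maxdiv (q ^ 2) ^ 4)%:R <= C * q%:R `^ eps.
Proof.
(* The choice [eps * m >= 2] lets the bound [maxdiv (q ^ 2) ^ (4 * m) <= C * q ^ 2] give the claim
   after an [m]-th root. *)
move=> e0; pose m := (Num.truncn (2 / eps)).+1.
have me : 2 <= eps * m%:R.
  by rewrite mulrC -ler_pdivrMr //; apply/ltW; apply: truncnS_gt.
have [C C0 HC] := @maxdiv_bound (4 * m) isT.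
exists C%:R; split=> // q q0.
have q1 : 1 <= q%:R :> R by rewrite ler1n.
rewrite -(@ler_pXn2r _ m) // ?nnegrE ?mulr_ge0 ?powR_ge0 //.
have := HC (q ^ 2)%N; rewrite expn_gt0 q0 => /(_ isT); rewrite expnM => Hq.
rewrite exprMn -!natrX -powR_mulrn ?powR_ge0 // -powRrM.
apply: (@le_trans _ _ (C * q ^ 2)%:R); first by rewrite ler_nat.
rewrite natrM ler_pM //.
  by rewrite ler_nat -{1}[C]expn1 leq_pexp2l.
by rewrite natrX -powR_mulrn //; apply: ler_powR.
Qed.

Lemma covered_set (T : choiceType) (X : set T) (n : nat) :
  covered X n -> finite_set X /\ (#|` fset_set X| <= n)%N.
Proof.
move=> [s sn sX]; have fX : finite_set X.
  by apply: (sub_finite_set _ (finite_seq s)) => x /sX.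
split=> //; apply: leq_trans sn; rewrite cardfE.
have : {subset enum_fset (fset_set X) <= s}.
  by move=> x; rewrite in_fset_set // inE => /sX.
move/(uniq_leq_size (fset_uniq _)); by rewrite -cardfE.
Qed.

Theorem theorem1p4 (R : realType) :
  exists C : R, 0 < C /\
    forall eps : R, 0 < eps ->
      exists A : R,
        forall (q : nat) (T : R),
          prime q -> 0 <= T -> T <= C * q%:R ^+ 2 ->
          finite_set (fixed_pairs q T) /\
          (#|` fset_set (fixed_pairs q T)|)%fset%:R
            <= A * (q%:R `^ (2 + eps)) * T.
Proof.
have [K HK] := covered_fixed_pairs_nat.
(* This constant turns the range of [T] into [256 * t <= q ^ 2]. *)
exists 256^-1; split; first by rewrite invr_gt0.
move=> eps e0; have [C [C0 HC]] := maxdiv_powR e0.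
exists (K%:R * C) => q T pq T0 Tq; have q0 := prime_gt0 pq.
(* The product of norms is an integer, so [T] may be truncated; [t <= T] keeps the final bound
   linear in [T]. *)
pose t := Num.truncn T.
have tT : t%:R <= T by rewrite truncn_le.
have tq : (256 * t <= q ^ 2)%N.
  rewrite -(ler_nat R) natrM natrX mulrC -ler_pdivlMr // mulrC.
  exact: le_trans Tq.
have Ct : covered (fixed_pairs q T) (K * (q ^ 2 * t * maxdiv (q ^ 2) ^ 4)).
  apply: (covered_sub (HK q t pq tq)) => // -[g x] [/= gT gx]; split=> //=.
  rewrite truncn_ge_nat //; apply: le_trans gT.
  rewrite -[X in X <= _]/((mnorm g * mnorm (invmx g))%N%:Z%:~R) ler_int PoszM.
  by apply: ler_pM; rewrite ?mnorm_le_mx_norm.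
have [fX cX] := covered_set Ct; split=> //.
apply: (@le_trans _ _ (K * (q ^ 2 * t * maxdiv (q ^ 2) ^ 4))%:R); first by rewrite ler_nat.
rewrite powRD; last by rewrite pnatr_eq0 -lt0n q0 implybT.
rewrite powR_mulrn //; have := HC q q0; move: (maxdiv _ ^ 4)%N => D DC.
have -> : (K * (q ^ 2 * t * D))%:R = K%:R * q%:R ^+ 2 * t%:R * D%:R :> R.
  by rewrite !natrM expr2 !mulrA.
have -> : K%:R * C * (q%:R ^+ 2 * q%:R `^ eps) * T = K%:R * q%:R ^+ 2 * T * (C * q%:R `^ eps).
  by ring.
by apply: ler_pM => //; rewrite ?mulr_ge0 ?exprn_ge0 // ler_wpM2l ?mulr_ge0 ?exprn_ge0.
Qed.
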